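(* Suppose $\theta$ is a real number such that either $e^{2\pi i\theta}$ is an algebraic number, or $\theta$ is badly approximable, i.e. it has a bounded sequence of partial quotients. Then the following holds: 1. Suppose $\dim_{\mathbf{Q}}\langle 1,\theta\rangle=2$. For all $m\in\mathbf{Z}$, we have $$\lim_{N\rightarrow\infty}\frac{1}{N}\sum_{n=1}^{N}\log\left|1-e^{2\pi in\theta}\right|\cdot e^{2\pi imn\theta}=-\frac{1}{2|m|}\delta_{m\neq0}.$$ If $m\in\mathbf{Q}\setminus\mathbf{Z}$, this limit is a value $$C_{m}\in\mathbf{Q}(\mu_{\infty},\pi,\{L(1,\chi)\}_{\chi}),$$ where $\chi$ ranges over a set of non-principal Dirichlet characters modulo $2v$, for $v\geq1$ the denominator of $m$ in lowest terms. The values $C_{m}$ only depend on $m$, and are independent of $\theta$. 2. If $\alpha$ is a real number and $\dim_{\mathbf{Q}}\langle 1,\theta,\alpha\rangle=3$, then for all $m\in\mathbf{Z}$, $$\lim_{N\rightarrow\infty}\frac{1}{N}\sum_{n=1}^{N}\log\left|1-e^{2\pi in\theta}\right|\cdot e^{2\pi imn\alpha}=0.$$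
   Context: $\langle\cdots\rangle$ denotes the $\mathbf{Q}$-linear span inside $\mathbf{R}$. The expression $-\frac{1}{2|m|}\delta_{m\ne0}$ means $-\frac1{2|m|}$ if $m\neq0$ and $0$ if $m=0$. An irrational real number $\theta$ is badly approximable if $\inf_{n\ge1} n\|n\theta\|>0$, where $\|\cdot\|$ is the distance to the nearest integer; equivalently its continued fraction partial quotients are bounded. $\mu_\infty$ is the set of all complex roots of unity, and $L(s,\chi)$ is the Dirichlet $L$-function. *)

(* Defs.v *)
(* MathComp-Analysis over an arbitrary [R : realType], with the
   complex numbers [R[i]] of mathcomp-real-closed. *)
From HB Require Import structures.
From mathcomp Require Import all_boot all_order all_algebra.
From mathcomp Require Import complex.
From mathcomp Require Import all_classical all_reals all_analysis.

Set Implicit Arguments.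
Unset Strict Implicit.
Unset Printing Implicit Defensive.

Import Order.TTheory GRing.Theory Num.Theory.
Import numFieldNormedType.Exports.

Local Open Scope classical_set_scope.
Local Open Scope complex_scope.
Local Open Scope ring_scope.

Section Exponentials.
Variable R : realType.

(* [cis x] is e^(ix) and [e2pi x] is e^(2 pi i x), for real [x]. *)
Definition cis (x : R) : R[i] := cos x +i* sin x.

Definition e2pi (x : R) : R[i] := cis (2 * pi * x).

(* [npow n s] is n^s = exp(s log n), for [n >= 1]. *)
Definition npow (n : nat) (s : R[i]) : R[i] :=
  (n%:R `^ complex.Re s)%:C * cis (complex.Im s * ln n%:R).

(* A limit in [R[i]]; the metric topology given by the complex modulus is
   carried by the alias [R[i]^o]. *)
Definition clim_to (u : nat -> R[i]) (l : R[i]) : Prop :=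
  (u : nat -> R[i]^o) @ \oo --> (l : R[i]^o).

(* The average (1/N) sum_{n=1}^N log|1 - e^(2 pi i n theta)| e^(2 pi i n beta);
   used with [beta = m * theta] and [beta = m * alpha]. *)
Definition log_average (theta beta : R) (N : nat) : R[i] :=
  N%:R^-1 * \sum_(1 <= n < N.+1)
    (ln (Normc.normc (1 - e2pi (n%:R * theta))))%:C * e2pi (n%:R * beta).

End Exponentials.

Section Diophantine.
Variable R : realType.

Definition dist_int (x : R) : R :=
  inf [set `|x - k%:~R| | k in [set: int]].

Definition badly_approximable (theta : R) : Prop :=
  irrational theta /\
  0 < inf [set n%:R * dist_int (n%:R * theta) | n in [set n : nat | (0 < n)%N]].

Definition Qspan (n : nat) (x : n.-tuple R) : set R :=
  [set y | exists c : 'I_n -> rat, y = \sum_(i < n) ratr (c i) * tnth x i].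

Definition Qfree (n : nat) (x : n.-tuple R) : Prop :=
  forall c : 'I_n -> rat,
    \sum_(i < n) ratr (c i) * tnth x i = 0 -> forall i, c i = 0.

(* [V] is a Q-linear subspace of R of dimension [d]: it has a Q-basis of
   length [d]. *)
Definition Qdim (V : set R) (d : nat) : Prop :=
  exists b : d.-tuple R, Qfree b /\ Qspan b = V.

End Diophantine.

Section Dirichlet.
Variable R : realType.

Definition dirichlet_character (q : nat) (chi : int -> R[i]) : Prop :=
  [/\ forall n, chi (n + q%:Z) = chi n,
      forall m n, chi (m * n) = chi m * chi n
    & forall n, (chi n != 0) = coprimez n q%:Z].

Definition principal_character (q : nat) (chi : int -> R[i]) : Prop :=
  forall n, chi n = (coprimez n q%:Z)%:R.

(* The Dirichlet series of [chi], summed in the natural order. It is used for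
   non-principal [chi] only; the series then converges to L(s, chi) for every s
   of positive real part, in particular for s = 1. *)
Definition dirichlet_L (s : R[i]) (chi : int -> R[i]) : R[i] :=
  lim ((fun N : nat => (\sum_(1 <= n < N.+1) chi n%:Z * npow n (- s) : R[i]^o))
         @ \oo).

Definition roots_of_unity : set R[i] :=
  [set z | exists2 n : nat, (0 < n)%N & n.-unity_root z].

(* The smallest subfield containing [A]; in characteristic 0 it is Q(A). *)
Definition field_generated (K : fieldType) (A : set K) : set K :=
  [set x | forall F : {pred K}, GRing.divring_closed F ->
     (forall y, A y -> y \in F) -> x \in F].

End Dirichlet.

(* Main.v *)
(* Put e(x) = exp(2 pi i x) and let ||x|| be the distance to the nearest integer.
   The truncated Fourier series of log|1 - e(x)| is within O((K ||x||)^(-1/2))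
   of it after K terms, so the statement reduces to a uniform bound on the
   average of this error over the points n theta, n <= N: the averages of the
   single modes e(n(k theta + beta)) are geometric sums and tend to 1 or 0.
   Let q be the best approximation denominator of theta up to N. In every block
   of q consecutive n the points n theta are 1/(2q)-separated, so the error
   sums like a Riemann sum, except for the two points nearest to an integer;
   these cost at most log(1/||q theta||) + O(1) each, for N/q blocks. The whole
   argument therefore only needs log(1/||q theta||) = o(q).

   This is immediate if theta is badly approximable. If a = e(theta) is
   algebraic it is Gelfond's theorem, proved here with an interpolation
   determinant in the manner of Laurent. If n theta is very close to m, then
   a^(r l) is nearly e(l x / n) at the integer x = r m + s n, so the determinant
   of the x^k a^(r l) is nearly an interpolation determinant of the entire
   functions x^k e(l x / n), which is tiny. A zero estimate makes some such
   determinant nonzero, and Liouville's inequality then bounds it from below.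

   For a non-integral m every mode averages to 0, so C_m = 0. *)
Require Import Defs.
From HB Require Import structures.
From mathcomp Require Import all_boot all_order all_algebra all_fingroup.
From mathcomp Require Import complex.
From mathcomp Require Import all_classical all_reals all_analysis.
From mathcomp Require Import ring lra zify.

Set Implicit Arguments.
Unset Strict Implicit.
Unset Printing Implicit Defensive.

Import Order.TTheory GRing.Theory Num.Theory.

Local Open Scope ring_scope.

(** * Determinants and the zero estimate *)

Lemma sum_perm_const (V : nmodType) n (x : V) : \sum_(s : 'S_n) x = x *+ n`!.
Proof. by rewrite big_const card_Sn iter_addr_0. Qed.

Lemma norm_det_le (R : numDomainType) n (A : 'M[R]_n) (b : R) :
  (forall i j, `|A i j| <= b) -> `|\det A| <= n`!%:R * b ^+ n.
Proof.
move=> Ab; apply: le_trans (ler_norm_sum _ _ _) _.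
rewrite mulr_natl -sum_perm_const.
apply: ler_sum => s _; rewrite normrM normrX normrN1 expr1n mul1r normr_prod.
rewrite -[n in b ^+ n]card_ord -prodr_const /=.
by apply: ler_prod => i _; rewrite normr_ge0 Ab.
Qed.

(** Induction, changing one factor at a time; [1 <= b] lets the full power of [b] bound the products
    of the other factors. *)
Lemma norm_prod_sub_le (R : numDomainType) (I : Type) (s : seq I) (F G : I -> R)
    (b e : R) : 1 <= b -> 0 <= e ->
  (forall i, `|F i| <= b) -> (forall i, `|G i| <= b) ->
  (forall i, `|F i - G i| <= e) ->
  `|\prod_(i <- s) F i - \prod_(i <- s) G i| <= (size s)%:R * b ^+ size s * e.
Proof.
move=> b1 e0 Fb Gb FG; have b0 : 0 <= b by exact: le_trans b1.
elim: s => [|i s IHs]; first by rewrite !big_nil subrr normr0 !mul0r.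
rewrite !big_cons.
have -> : F i * \prod_(j <- s) F j - G i * \prod_(j <- s) G j =
  (F i - G i) * \prod_(j <- s) F j +
  G i * (\prod_(j <- s) F j - \prod_(j <- s) G j).
  by rewrite mulrBl mulrBr addrA subrK.
have PF : `|\prod_(j <- s) F j| <= b ^+ (size s).+1.
  apply: (@le_trans _ _ (b ^+ size s)); last by rewrite exprS ler_peMl ?exprn_ge0.
  rewrite normr_prod -iter_mulr_1 -(count_predT s) -big_const_seq.
  by apply: ler_prod => j _; rewrite normr_ge0 Fb.
apply: le_trans (ler_normD _ _) _; rewrite !normrM /= -[(size s).+1]add1n natrD.
rewrite mulrDl mulrDl mul1r lerD //; first by rewrite mulrC ler_pM.
rewrite mulrC (le_trans (ler_pM _ _ IHs (Gb i))) //.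
by rewrite -!mulrA ler_wpM2l // [b ^+ (1 + _)]exprSr -mulrA [b * e]mulrC.
Qed.

Lemma norm_det_sub_le (R : numDomainType) n (A B : 'M[R]_n) (b e : R) :
  1 <= b -> 0 <= e ->
  (forall i j, `|A i j| <= b) -> (forall i j, `|B i j| <= b) ->
  (forall i j, `|A i j - B i j| <= e) ->
  `|\det A - \det B| <= n`!%:R * (n%:R * b ^+ n * e).
Proof.
move=> b1 e0 Ab Bb AB; rewrite -sumrB; apply: le_trans (ler_norm_sum _ _ _) _.
rewrite mulr_natl -sum_perm_const.
apply: ler_sum => s _; rewrite -mulrBr normrM normrX normrN1 expr1n mul1r.
have sz : size (index_enum 'I_n) = n by rewrite -[RHS]card_ord cardE enumT.
have := @norm_prod_sub_le R 'I_n (index_enum 'I_n) (fun i => A i (s i))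
  (fun i => B i (s i)) b e b1 e0.
by rewrite sz; apply.
Qed.

Lemma sorted_ltn_nth_ge (s : seq nat) i :
  sorted ltn s -> (i < size s)%N -> (i <= nth 0 s i)%N.
Proof.
move=> ss; elim: i => // i IH lt_i.
apply: (leq_ltn_trans (IH (ltnW lt_i))).
by apply: (sorted_ltn_nth ltn_trans 0%N ss); rewrite ?inE // ltnW.
Qed.

(** Once sorted, the entry of index [i] is at least [i], and ['C(n, 2)] is the sum of all
    [i < n]. *)
Lemma sum_uniq_ge (s : seq nat) : uniq s -> ('C(size s, 2) <= \sum_(i <- s) i)%N.
Proof.
move=> us; rewrite -(size_sort leq) -bin2_sum.
have -> : (\sum_(i <- s) i = \sum_(i <- sort leq s) i)%N.
  by apply: perm_big; rewrite perm_sym perm_sort.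
have : sorted ltn (sort leq s).
  by rewrite ltn_sorted_uniq_leq sort_uniq us sort_sorted //; exact: leq_total.
move: (sort leq s) => {us}s ss; rewrite [leqRHS](big_nth 0%N) big_nat_cond [leqRHS]big_nat_cond.
by apply: leq_sum => i; rewrite andbT => /andP[_]; exact: sorted_ltn_nth_ge.
Qed.

Lemma sum_inj_ge N (f : 'I_N -> nat) : injective f -> ('C(N, 2) <= \sum_i f i)%N.
Proof.
move=> injf; have := @sum_uniq_ge (map f (enum 'I_N)).
by rewrite map_inj_uniq ?enum_uniq // size_map size_enum_ord big_map big_enum; apply.
Qed.

(* Expanding every column in powers of [z i], only the terms with pairwise
   distinct exponents survive, and those have total degree at least 'C(N, 2). *)
Lemma interpolation_det_le (C : numDomainType) N J (z : 'I_N -> C)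
    (f : 'I_N -> {poly C}) (rho E : C) :
  1 <= E -> 0 <= rho -> (forall i, `|z i| <= rho) -> (forall j, size (f j) <= J)%N ->
  E ^+ 'C(N, 2) * `|\det (\matrix_(i, j) (f j).[z i])| <=
  N`!%:R * \prod_j \sum_(p < J) `|(f j)`_p| * (E * rho) ^+ p.
Proof.
move=> E1 rho0 zrho szf; have E0 : 0 <= E by exact: le_trans E1.
pose V (g : {ffun 'I_N -> 'I_J}) := \matrix_(j < N, i < N) z i ^+ g j.
have -> : \det (\matrix_(i, j) (f j).[z i]) =
    \sum_(g : {ffun 'I_N -> 'I_J}) (\prod_j (f j)`_(g j)) * \det (V g).
  rewrite -det_tr /determinant.
  transitivity (\sum_(s : 'S_N) \sum_(g : {ffun 'I_N -> 'I_J})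
      (-1) ^+ s * \prod_j ((f j)`_(g j) * z (s j) ^+ g j)).
    apply: eq_bigr => s _; rewrite -big_distrr /=.
    rewrite -(bigA_distr_bigA (fun j (p : 'I_J) => (f j)`_p * z (s j) ^+ p)) /=.
    congr (_ * _); apply: eq_bigr => j _.
    by rewrite !mxE (horner_coef_wide _ (szf j)).
  rewrite exchange_big /=; apply: eq_bigr => g _.
  rewrite big_distrr /=; apply: eq_bigr => s _.
  rewrite big_split /= mulrCA; congr (_ * (_ * _)).
  by apply: eq_bigr => j _; rewrite !mxE.
apply: (@le_trans _ _ (\sum_(g : {ffun 'I_N -> 'I_J})
    N`!%:R * \prod_j (`|(f j)`_(g j)| * (E * rho) ^+ g j))); last first.
  rewrite -big_distrr /=.
  by rewrite -(bigA_distr_bigA (fun j (p : 'I_J) => `|(f j)`_p| * (E * rho) ^+ p)).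
apply: le_trans (ler_wpM2l (exprn_ge0 _ E0) (ler_norm_sum _ _ _)) _.
rewrite big_distrr /=; apply: ler_sum => g _.
rewrite normrM normr_prod big_split /= mulrCA [leRHS]mulrCA.
apply: ler_wpM2l; first by apply: prodr_ge0.
have [/injectiveP injg|/injectivePn [j1 [j2 nj12 ej12]]] := boolP (injectiveb g); last first.
  rewrite (@determinant_alternate _ _ (V g) j1 j2 nj12) ?normr0 ?mulr0.
    by rewrite mulr_ge0 // prodr_ge0 // => j _; rewrite exprn_ge0 // mulr_ge0.
  by move=> i; rewrite !mxE ej12.
have detV : `|\det (V g)| <= N`!%:R * \prod_j rho ^+ g j.
  apply: le_trans (ler_norm_sum _ _ _) _.
  rewrite mulr_natl -sum_perm_const.
  apply: ler_sum => s _; rewrite normrM normrX normrN1 expr1n mul1r normr_prod.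
  by apply: ler_prod => i _; rewrite normr_ge0 mxE normrX lerXn2r ?nnegrE ?zrho.
(* The gain of Schwarz's lemma: [E] is the ratio of two radii, and the distinct exponents [g i] have
   sum at least ['C(N, 2)]. *)
have -> : \prod_(i < N) (E * rho) ^+ g i = E ^+ (\sum_i g i) * \prod_i rho ^+ g i.
  by rewrite -prodrXr -big_split /=; apply: eq_bigr => j _; rewrite exprMn.
rewrite [leRHS]mulrCA; apply: ler_pM => //; first by rewrite exprn_ge0.
apply: ler_weXn2l => //.
by apply: (@sum_inj_ge N (fun i => nat_of_ord (g i))) => i j /val_inj /injg.
Qed.

(** The [d i] only bound the degrees: in the convolution at the index [\sum d i], every term but one
    has a factor beyond its degree bound. *)
Lemma prod_coef_top (R : comNzRingType) (I : Type) (s : seq I)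
    (F : I -> {poly R}) (d : I -> nat) :
  (forall i, size (F i) <= (d i).+1)%N ->
  (size (\prod_(i <- s) F i)%R <= (\sum_(i <- s) d i).+1)%N /\
  (\prod_(i <- s) F i)`_(\sum_(i <- s) d i) = \prod_(i <- s) (F i)`_(d i).
Proof.
move=> Fd; elim: s => [|i s [sz co]]; first by rewrite !big_nil size_poly1 coef1.
rewrite !big_cons; split.
  apply: leq_trans (size_polyMleq _ _) _.
  by have := leq_add (Fd i) sz; case: (_ + _)%N => //= n; rewrite addSn addnS.
rewrite -co coefM (bigD1 (Ordinal (leq_addr (\sum_(j <- s) d j) (d i) : (d i < _.+1)%N))) //=.
rewrite addKn [X in _ + X]big1 ?addr0 // => k.
rewrite -val_eqE /= neq_ltn => /orP[lt_k|lt_k].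
  rewrite [X in _ * X]nth_default ?mulr0 //; apply: leq_trans sz _.
  by rewrite ltn_subRL ltn_add2r.
by rewrite [X in X * _]nth_default ?mul0r //; exact: leq_trans (Fd i) _.
Qed.

(** The bound [d j] depends on the column alone, so all terms of Leibniz's formula have the same top
    index. *)
Lemma det_coef_top (R : comNzRingType) n (M : 'M[{poly R}]_n) (d : 'I_n -> nat) :
  (forall i j, size (M i j) <= (d j).+1)%N ->
  (size (\det M) <= (\sum_j d j).+1)%N /\
  (\det M)`_(\sum_j d j) = \det (\matrix_(i, j) (M i j)`_(d j)).
Proof.
move=> Md; rewrite -det_tr -[in RHS]det_tr /determinant.
have H (s : 'S_n) : (size (\prod_i M^T i (s i))%R <= (\sum_j d j).+1)%N /\
    (\prod_i M^T i (s i))`_(\sum_j d j) = \prod_i (M^T i (s i))`_(d i).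
  by apply: prod_coef_top => i; rewrite mxE.
split.
  apply: leq_trans (size_sum _ _ _) _; apply/bigmax_leqP => s _.
  by rewrite mulr_sign; case: ifP => _; rewrite ?size_polyN; case: (H s).
rewrite coef_sum; apply: eq_bigr => s _.
rewrite mulr_sign [RHS]mulr_sign; case: ifP => _; rewrite ?coefN (H s).2.
  by congr (- _); apply: eq_bigr => i _; rewrite !mxE.
by apply: eq_bigr => i _; rewrite !mxE.
Qed.

(* With [nu] the number of nonzero [P l], the determinant of the translates
   [P l (X + i u) y ^ (i l)], [i < nu], has degree at most [(K - 1) L]; its top
   coefficient is a Vandermonde determinant in the [y ^ l], and it vanishes at
   the [T ^ 2] points [r u + s v]. *)
Lemma zero_estimate (F : fieldType) (K L T : nat) (u v y : F) (P : 'I_L -> {poly F}) :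
  y != 0 -> (forall i j, (i < L)%N -> (j < L)%N -> y ^+ i = y ^+ j -> i = j) ->
  injective (fun p : 'I_T * 'I_T => p.1%:R * u + p.2%:R * v) ->
  (K.-1 * L < T ^ 2)%N -> (forall l, size (P l) <= K)%N ->
  (forall r s, (r < L + T)%N -> (s < T)%N ->
     \sum_l (P l).[r%:R * u + s%:R * v] * y ^+ (r * l) = 0) ->
  forall l, P l = 0.
Proof.
move=> y0 yinj xinj KLT szP P0 l0; apply: contrapT => /eqP nzl0.
pose S := [set l | P l != 0]; pose nu := #|S|; pose e (j : 'I_nu) : 'I_L := enum_val j.
have l0S : l0 \in S by rewrite inE.
have nu_gt0 : (0 < nu)%N by apply/card_gt0P; exists l0.
have nuL : (nu <= L)%N by rewrite -[L]card_ord max_card.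
have eS j : P (e j) != 0 by have := enum_valP j; rewrite inE.
pose M := \matrix_(i < nu, j < nu)
  ((P (e j) \Po ('X + ((i : nat)%:R * u)%:P)) * (y ^+ (i * e j))%:P).
pose d (j : 'I_nu) := (size (P (e j))).-1.
have szXu c : size ('X + c%:P : {poly F}) = 2 by rewrite size_XaddC.
have szcomp i j : size (P (e j) \Po ('X + ((i : nat)%:R * u)%:P)) = size (P (e j)).
  by rewrite size_comp_poly2.
have Md i j : (size (M i j) <= (d j).+1)%N.
  rewrite mxE mulrC mul_polyC; apply: leq_trans (size_scale_leq _ _) _.
  by rewrite szcomp prednK // size_poly_gt0.
have [szD coD] := det_coef_top Md.
have nzD : \det M != 0.
  apply: contra_eq_neq coD => ->; rewrite coef0 eq_sym.
  (* Translation keeps leading coefficients, so column [j] consists of the powers of [y ^ e j] times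
     [lead_coef (P (e j))]. *)
  have -> : (\matrix_(i, j) (M i j)`_(d j)) =
      Vandermonde nu (\row_j y ^+ e j) *m diag_mx (\row_j lead_coef (P (e j))).
    apply/matrixP => i j; rewrite !mxE coefMC.
    rewrite (bigD1 j) //= big1 ?addr0 => [|k /negPf nkj]; last by rewrite !mxE nkj mulr0n mulr0.
    rewrite !mxE eqxx mulr1n mulrC -exprM [(e j * i)%N]mulnC; congr (_ * _).
    rewrite /d -(szcomp i j) -/(lead_coef _) lead_coef_comp ?szXu //.
    by rewrite lead_coefXaddC expr1n mulr1.
  rewrite det_mulmx det_diag mulf_neq0 // ?det_Vandermonde.
    apply/prodf_neq0 => i _; apply/prodf_neq0 => j ltij.
    rewrite !mxE subr_eq0; apply: contraTneq ltij => /yinj.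
    by move=> /(_ (ltn_ord _) (ltn_ord _)) /val_inj /enum_val_inj ->; rewrite ltnn.
  by apply/prodf_neq0 => j _; rewrite mxE lead_coef_eq0.
pose x (p : 'I_T * 'I_T) := p.1%:R * u + p.2%:R * v.
(* The vector of the [y ^ (r * l)] is in the kernel at [r u + s v]: row [i] is the hypothesis at
   [(r + i, s)], and [r + i < L + T] since [i < nu <= L]. *)
have rootD p : root (\det M) (x p).
  rewrite /root -horner_evalE -det_map_mx -det_tr; apply/det0P.
  exists (\row_j y ^+ (p.1 * e j)).
    apply/negP => /eqP/rowP/(_ (Ordinal nu_gt0)); rewrite !mxE => /eqP.
    by rewrite expf_eq0 (negPf y0) andbF.
  apply/rowP => i; rewrite !mxE.
  have ltr : (i + p.1 < L + T)%N by rewrite -addnS leq_add // ltnW // (leq_trans (ltn_ord i)).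
  rewrite -[RHS](P0 _ p.2 ltr (ltn_ord _)).
  rewrite [RHS](bigID (mem S)) /= [X in _ + X]big1 ?addr0; last first.
    by move=> l; rewrite inE negbK => /eqP ->; rewrite horner0 mul0r.
  rewrite [RHS]big_enum_val; apply: eq_bigr => j _.
  rewrite !mxE horner_evalE hornerM hornerC horner_comp !hornerE -/(e j).
  rewrite mulnDl exprD /x natrD mulrDl.
  have -> : i%:R * u + p.1%:R * u + p.2%:R * v = p.1%:R * u + p.2%:R * v + i%:R * u.
    by ring.
  by rewrite /= [RHS]mulrCA [y ^+ (p.1 * e j) * _]mulrC; ring.
have := @max_poly_roots _ (\det M) (map x (enum {: 'I_T * 'I_T})) nzD.
rewrite map_inj_uniq // enum_uniq size_map -cardE card_prod !card_ord => /(_ _ isT).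
have -> : all (root (\det M)) [seq x i | i <- enum {: 'I_T * 'I_T}].
  by apply/allP => _ /mapP[p _ ->]; exact: rootD.
move=> /(_ isT); apply/negP; rewrite -leqNgt (leq_trans szD) //.
apply: leq_ltn_trans KLT; apply: (@leq_trans (\sum_(j < nu) K.-1)).
  by apply: leq_sum => j _; rewrite /d -!subn1 leq_sub2r.
by rewrite sum_nat_const card_ord mulnC leq_mul.
Qed.

Lemma exists_minor (F : fieldType) m n (A : 'M[F]_(m, n)) :
  (forall c : 'cV_n, A *m c = 0 -> c = 0) ->
  exists f : 'I_n -> 'I_m, \det (rowsub f A) != 0.
Proof.
move=> kerA; suff Afull : row_full A.
  exists (fullrankfun Afull).
  by have := fullrowsub_unit Afull; rewrite unitmxE unitfE.
rewrite /row_full -mxrank_tr -/(row_free A^T) -kermx_eq0.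
apply/eqP/row_matrixP => i; rewrite row0.
have /(congr1 trmx) : row i (kermx A^T) *m A^T = 0 by apply: sub_kermxP; exact: row_sub.
by rewrite trmx_mul trmxK trmx0 => /kerA /(congr1 trmx); rewrite trmxK trmx0.
Qed.

(** A relation between the columns [(k, l)] would be a family of polynomials [P l] of degree below
    [K], which [zero_estimate] forces to vanish; hence some maximal minor is nonzero. *)
Lemma monomial_minor (F : fieldType) (K L T : nat) (u v y : F) :
  y != 0 -> (forall i j, (i < L)%N -> (j < L)%N -> y ^+ i = y ^+ j -> i = j) ->
  injective (fun p : 'I_T * 'I_T => p.1%:R * u + p.2%:R * v) ->
  (K.-1 * L < T ^ 2)%N ->
  exists N (r s k l : 'I_N -> nat),
    [/\ N = (K * L)%N, forall i, (r i < L + T)%N, forall i, (s i < T)%N,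
        forall j, (k j < K)%N /\ (l j < L)%N &
        \det (\matrix_(i, j) (((r i)%:R * u + (s i)%:R * v) ^+ k j * y ^+ (r i * l j))) != 0].
Proof.
move=> y0 yinj xinj KLT.
pose I : finType := ('I_(L + T) * 'I_T)%type; pose J : finType := ('I_K * 'I_L)%type.
pose A := \matrix_(i < #|I|, j < #|J|)
  (((enum_val i).1%:R * u + (enum_val i).2%:R * v) ^+ (enum_val j).1 *
    y ^+ ((enum_val i).1 * (enum_val j).2)).
have [c Ac|f nzf] := @exists_minor F #|I| #|J| A.
  (* [insub] casts the index [k < K] to an ordinal; the default 0 is never reached. *)
  pose P (l : 'I_L) := \poly_(k < K)
    (if insub k is Some k then c (enum_rank ((k, l) : J)) 0 else 0).
  have P0 : forall l, P l = 0.
    apply: (zero_estimate y0 yinj xinj KLT) => [l|r s ltr lts]; first exact: size_poly.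
    pose p : I := (Ordinal ltr, Ordinal lts).
    have /matrixP/(_ (enum_rank p) 0) := Ac; rewrite !mxE => Ep.
    rewrite -[RHS]Ep.
    rewrite (reindex (fun kl : J => enum_rank kl)) /=; last first.
      by exists enum_val => j _; rewrite ?enum_rankK ?enum_valK.
    pose G k l := A (enum_rank p) (enum_rank ((k, l) : J)) * c (enum_rank ((k, l) : J)) 0.
    rewrite [RHS](eq_bigr (fun kl => G kl.1 kl.2)) => [|[] //].
    rewrite -(pair_bigA _ G) /= /G.
    rewrite exchange_big /=; apply: eq_bigr => l _.
    rewrite /P horner_poly mulr_suml; apply: eq_bigr => k _.
    rewrite insubT // => ltk; rewrite !mxE !enum_rankK /= (_ : Sub _ _ = k); last exact: val_inj.
    by ring.
  apply/colP => j; rewrite mxE -[j]enum_valK; case: (enum_val j) => k l.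
  have /polyP/(_ k) := P0 l; rewrite coef_poly coef0 ltn_ord insubT // => ltk.
  by rewrite (_ : Sub _ _ = k) //; exact: val_inj.
pose pt i : I := enum_val (f i); pose mn (j : 'I_#|J|) : J := enum_val j.
exists #|J|, (fun i => (pt i).1 : nat), (fun i => (pt i).2 : nat).
exists (fun j => (mn j).1 : nat), (fun j => (mn j).2 : nat).
split=> //; first by rewrite card_prod !card_ord.
apply: contra_neq nzf => nzf; rewrite -[RHS]nzf; congr (\det _).
by apply/matrixP => i j; rewrite !mxE.
Qed.

(* [M] is multiplication by [lead_coef q * a] on [1, a, .., a ^ (d - 1)], where
   [q] is an integer polynomial of minimal degree [d] vanishing at [a]. A sum
   [S] of integer multiples of powers of [a] then becomes an integer matrix
   [B], and [\adj B] bounds [1 <= `|\det B|] by a multiple of [`|S|]. *)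
Lemma liouville (C : numFieldType) (a : C) (q0 : {poly int}) :
  `|a| = 1 -> q0 != 0 -> root (map_poly intr q0) a ->
  exists w d : nat,
    forall (I : finType) (c : I -> int) (n : I -> nat) (D H : nat),
      (forall i, n i <= D)%N -> \sum_i `|c i| <= H%:R ->
      \sum_i (c i)%:~R * a ^+ n i != 0 ->
      1 <= (w ^ D.+1 * H ^ d)%:R * `|\sum_i (c i)%:~R * a ^+ n i|.
Proof.
move=> a1 nzq0 rq0.
pose V (s : nat) := `[< exists q : {poly int},
  [/\ q != 0, size q = s & root (map_poly intr q) a] >].
have exV : exists s, V s by exists (size q0); apply/asboolP; exists q0.
case: (ex_minnP exV) => s /asboolP[q [nzq szq rq]] mins.
have minq (p : {poly int}) : (size p < size q)%N -> root (map_poly intr p) a -> p = 0.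
  move=> ltp rp; apply/eqP; apply: contraLR ltp => nzp; rewrite -leqNgt szq.
  by apply: mins; apply/asboolP; exists p.
have sz_gt1 : (1 < size q)%N.
  rewrite ltnNge; apply/negP => /size1_polyC Eq.
  move: rq nzq; rewrite Eq map_polyC /= rootC intr_eq0 => /eqP ->.
  by rewrite polyC0 eqxx.
have [e szqe] : exists e, size q = e.+2 by case: (size q) sz_gt1 => [|[|e]] // _; exists e.
pose M : 'M[int]_e.+1 := \matrix_(i, j)
  (if (i.+1 < e.+1)%N then lead_coef q *+ (j == i.+1 :> nat) else - q`_j).
pose v : 'cV[C]_e.+1 := \col_i a ^+ i.
pose toC := map_mx (intr : int -> C).
pose la : C := (lead_coef q)%:~R.
have Mv : toC _ _ M *m v = (la * a) *: v.
  apply/colP => i; rewrite !mxE.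
  case: (ltnP i.+1 e.+1) => [lti|gei].
    rewrite (bigD1 (Ordinal lti)) //= big1 ?addr0 => [|j nj].
      by rewrite !mxE lti eqxx /= exprS mulrA.
    by rewrite !mxE lti -(inj_eq val_inj) /= in nj *; rewrite (negPf nj) mul0r.
  have -> : i = ord_max by apply/val_inj/eqP; rewrite eqn_leq -ltnS ltn_ord -ltnS.
  rewrite /= -mulrA -exprS.
  have szc : (size (map_poly (intr : int -> C) q) <= e.+2)%N by rewrite -szqe; exact: size_poly.
  move/rootP: rq; rewrite (horner_coef_wide _ szc).
  rewrite big_ord_recr /= coef_map /= /la lead_coefE szqe /= => /eqP.
  rewrite addr_eq0 => /eqP E; apply: oppr_inj; rewrite -E -sumrN.
  by apply: eq_bigr => j _; rewrite !mxE ltnn coef_map /= -mulNr rmorphN opprK.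
pose w0 := (\sum_(j < e.+2) absz (q`_j)%R)%N.
have qw0 j : (j < e.+2)%N -> `|q`_j| <= w0%:R :> int.
  move=> ltj; rewrite -abszE natz lez_nat /w0 (bigD1 (Ordinal ltj)) //=.
  exact: leq_addr.
have w0_gt0 : (0 < w0)%N.
  rewrite /w0 big_ord_recr /= ltn_addl // absz_gt0.
  by have := lead_coef_eq0 q; rewrite lead_coefE szqe /= => ->.
have Mw0 i j : `|M i j| <= w0%:R :> int.
  rewrite mxE; case: ifP => _; last by rewrite normrN qw0 // ltnS ltnW.
  case: eqP => _; last by rewrite mulr0n normr0.
  by rewrite mulr1n lead_coefE szqe qw0.
pose W := (e.+1 * w0)%N.
have W_gt0 : (0 < W)%N by rewrite muln_gt0.
have lcW : `|lead_coef q| <= W%:R :> int.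
  rewrite lead_coefE szqe (le_trans (qw0 _ _)) // ler_nat.
  by rewrite /W leq_pmull.
have MW n i j : `|(M ^+ n) i j| <= W%:R ^+ n :> int.
  elim: n i j => [|n IHn] i j.
    by rewrite !expr0 mxE; case: eqP => _; rewrite ?normr1 ?normr0.
  rewrite exprS mxE; apply: le_trans (ler_norm_sum _ _ _) _.
  apply: (@le_trans _ _ (\sum_(k < e.+1) w0%:R * W%:R ^+ n)).
    by apply: ler_sum => k _; rewrite normrM ler_pM.
  by rewrite sumr_const card_ord -[_ *+ e.+1]mulr_natl mulrA exprS -natrM.
(* The entries of [\adj B] are minors of order [e], which explains [H ^ e]; the exponent [D.+1],
   rather than [D], absorbs the factorial. *)
exists (e.+1`! * W ^ e.+1)%N, e => I c n D H nD cH; set S := \sum_i _ => nzS.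
have H_gt0 : (0 < H)%N.
  rewrite lt0n; apply: contra nzS => /eqP H0; rewrite H0 in cH.
  have c0 i : c i = 0.
    have /eqP : \sum_i `|c i| = 0 by apply/le_anti; rewrite cH sumr_ge0.
    by rewrite psumr_eq0 // => /allP/(_ i (mem_index_enum _)) /=; rewrite normr_eq0 => /eqP.
  by rewrite /S big1 // => i _; rewrite c0 mul0r.
(* Powers of the leading coefficient make all terms homogeneous: [B] acts on [v] as
   [lead_coef q ^ D * S]. *)
pose B := \sum_i (c i * lead_coef q ^+ (D - n i)) *: M ^+ n i.
have BHW i j : `|B i j| <= (H * W ^ D)%:R.
  rewrite /B summxE; apply: le_trans (ler_norm_sum _ _ _) _.
  rewrite natrM natrX; apply: (@le_trans _ _ (\sum_i0 `|c i0| * W%:R ^+ D)); last first.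
    by rewrite -mulr_suml ler_wpM2r // exprn_ge0.
  apply: ler_sum => k _; rewrite mxE normrM normrM -mulrA ler_wpM2l //.
  rewrite -{2}(subnK (nD k)) exprD ler_pM // normrX lerXn2r ?nnegrE //.
have Bv : toC _ _ B *m v = (la ^+ D * S) *: v.
  have Mnv m : toC _ _ (M ^+ m) *m v = (la * a) ^+ m *: v.
    elim: m => [|m IHm]; first by rewrite !expr0 /toC map_mx1 mul1mx scale1r.
    rewrite exprSr /toC map_mxM -mulmxA -/(toC _ _ M) Mv -scalemxAr IHm scalerA.
    by rewrite -exprS.
  rewrite /toC /B map_mx_sum mulmx_suml mulr_sumr scaler_suml.
  apply: eq_bigr => i _; rewrite map_mxZ -scalemxAl -/(toC _ _ _) Mnv scalerA.
  congr (_ *: _); rewrite rmorphM rmorphXn exprMn -/la.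
  by rewrite -{2}(subnK (nD i)) exprD; ring.
have nzla : la != 0 by rewrite /la intr_eq0 lead_coef_eq0.
(* If [x *m B = 0] then [x *m v = 0], as [B] acts on [v] by a nonzero scalar. So [x] holds the
   coefficients of a polynomial of degree below that of [q] vanishing at [a], and [x = 0] by
   minimality. *)
have nzB : \det B != 0.
  apply/det0P => -[x nzx xB0].
  have /(congr1 (fun A => A *m v)) : toC _ _ (x *m B) = 0 by rewrite xB0 /toC map_mx0.
  rewrite /toC map_mxM -mulmxA -!/(toC _ _ _) Bv mul0mx -scalemxAr => /eqP.
  rewrite scalemx_eq0 mulf_eq0 expf_eq0 (negPf nzla) andbF (negPf nzS) /= => /eqP/matrixP/(_ 0 0).
  rewrite !mxE => xv0; apply: (negP nzx); apply/eqP/rowP => j; rewrite mxE.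
  pose xp := \poly_(i < e.+1) x 0 (inord i).
  have szp : (size xp <= e.+1)%N by exact: size_poly.
  have : xp = 0.
    apply: minq; first by rewrite szqe ltnS.
    apply/rootP; rewrite -[RHS]xv0.
    have szc : (size (map_poly (intr : int -> C) xp) <= e.+1)%N.
      by apply: leq_trans szp; exact: size_poly.
    rewrite (horner_coef_wide _ szc); apply: eq_bigr => i _.
    by rewrite coef_map /xp coef_poly ltn_ord inord_val !mxE.
  by move=> /polyP/(_ j); rewrite /xp coef_poly coef0 ltn_ord inord_val.
(* The first entry of [v] is 1, so the first row of [\adj B *m B = (\det B)%:M] exhibits [\det B] as
   a multiple of [S]. *)
have := congr1 (fun A => toC _ _ A *m v) (mul_adj_mx B).
rewrite /toC map_mxM -mulmxA -!/(toC _ _ _) Bv /toC map_scalar_mx mul_scalar_mx.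
move=> /matrixP/(_ 0 0); rewrite -scalemxAr !mxE /= expr0 mulr1 => Edet.
have det1 : 1 <= `|(\det B)%:~R| :> C.
  by rewrite -intr_norm -[1]/(1%:~R) ler_int; move: nzB; rewrite -normr_gt0 -gtz0_ge1.
apply: (le_trans det1); rewrite -Edet normrM normrM normrX.
have natC m : m%:R = (m%:R : int)%:~R :> C by rewrite natz -pmulrn.
have laW : `|la| <= W%:R by rewrite /la -intr_norm natC ler_int.
have adjB : `|\sum_j map_mx (intr : int -> C) (\adj B) 0 j * v j 0| <=
    (e.+1`! * (H * W ^ D) ^ e)%:R.
  apply: le_trans (ler_norm_sum _ _ _) _.
  rewrite factS -mulnA natrM mulr_natl -[e.+1 in leRHS]card_ord -sumr_const.
  apply: ler_sum => j _; rewrite !mxE normrM normrX a1 expr1n mulr1.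
  rewrite -intr_norm /cofactor normrM normrX normrN1 expr1n mul1r.
  rewrite natC ler_int natrM natrX.
  by apply: norm_det_le => i k; rewrite !mxE BHW.
apply: (@le_trans _ _ (W%:R ^+ D * `|S| * (e.+1`! * (H * W ^ D) ^ e)%:R)).
  apply: ler_pM; rewrite ?mulr_ge0 ?exprn_ge0 //.
  by rewrite ler_wpM2r // lerXn2r ?nnegrE.
rewrite -natrX mulrAC -natrM ler_wpM2r // ler_nat.
set f := e.+1`!; have f_gt0 : (0 < f)%N by exact: fact_gt0.
have -> : (W ^ D * (f * (H * W ^ D) ^ e) = f * W ^ (e.+1 * D) * H ^ e)%N.
  by rewrite expnMn -expnM mulSn expnD [(e * D)%N]mulnC; lia.
rewrite leq_mul2r expnMn -expnM leq_mul ?orbT //.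
  by rewrite -{1}[f]expn1 leq_pexp2l.
by rewrite leq_pexp2l // leq_mul2l leqnSn orbT.
Qed.

Import numFieldNormedType.Exports.

Local Open Scope classical_set_scope.
Local Open Scope complex_scope.
Local Open Scope ring_scope.

(** * The exponential map *)

Section Derivatives.
Variable R : realType.
Implicit Types (f g : R -> R).

(** The mean value theorem for [g + f] and [g - f]. Derivatives are taken in the open interval only,
    so that [dg] may blow up at an end, as in [log_cos_approx]. *)
Lemma norm_sub_le_of_derive f g (df dg : R -> R) (a b : R) : a <= b ->
  (forall x, x \in `]a, b[ -> is_derive x 1 f (df x)) ->
  (forall x, x \in `]a, b[ -> is_derive x 1 g (dg x)) ->
  {within `[a, b], continuous f} -> {within `[a, b], continuous g} ->
  (forall x, x \in `]a, b[ -> `|df x| <= dg x) ->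
  `|f b - f a| <= g b - g a.
Proof.
rewrite le_eqVlt => /predU1P[-> *|ab derf derg cf cg fg].
  by rewrite !subrr normr0.
have dP x : x \in `]a, b[ -> is_derive x 1 (fun t => g t + f t) (dg x + df x).
  by move=> xab; apply: is_deriveD; [exact: derg|exact: derf].
have dM x : x \in `]a, b[ -> is_derive x 1 (fun t => g t - f t) (dg x - df x).
  by move=> xab; apply: is_deriveB; [exact: derg|exact: derf].
have cP : {within `[a, b], continuous (fun t => g t + f t)}.
  by move=> x; apply: continuousD; [exact: cg|exact: cf].
have cM : {within `[a, b], continuous (fun t => g t - f t)}.
  by move=> x; apply: continuousB; [exact: cg|exact: cf].
have [c1 c1ab e1] := MVT ab dP cP; have [c2 c2ab e2] := MVT ab dM cM.
have := fg _ c1ab; have := fg _ c2ab; rewrite !ler_norml => /andP[l1 u1] /andP[l2 u2].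
have h1 : 0 <= (dg c1 + df c1) * (b - a) by rewrite mulr_ge0 ?subr_ge0 ?(ltW ab) //; lra.
have h2 : 0 <= (dg c2 - df c2) * (b - a) by rewrite mulr_ge0 ?subr_ge0 ?(ltW ab) //; lra.
by apply/andP; split; lra.
Qed.

Lemma norm_cos_sub (x y : R) : `|cos x - cos y| <= `|x - y|.
Proof.
wlog xy : x y / y <= x.
  by move=> H; case: (leP y x) => [/H//|/ltW/H]; rewrite distrC [`|y - x|]distrC.
rewrite [leRHS]ger0_norm ?subr_ge0 //.
apply: (@norm_sub_le_of_derive cos id (fun t => - sin t) (fun=> 1) y x xy).
- by apply: continuous_subspaceT; exact: continuous_cos.
- by apply: continuous_subspaceT => t; exact: cvg_id.
- by move=> t _; rewrite normrN sin_max.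
Qed.

Lemma norm_sin_sub (x y : R) : `|sin x - sin y| <= `|x - y|.
Proof.
have := norm_cos_sub (x - pi / 2) (y - pi / 2).
by rewrite !cosBpihalf opprB addrA subrK.
Qed.

(** The function [sin t - t * cos t] vanishes at 0 and has derivative [t * sin t >= 0]. *)
Lemma sin_ge_mul_cos (x : R) : 0 <= x -> x <= pi / 2 -> x * cos x <= sin x.
Proof.
move=> x0 xpi.
have := @norm_sub_le_of_derive (fun=> 0) (fun t => sin t - t * cos t)
  (fun=> 0) (fun t => t * sin t) 0 x x0.
rewrite subrr normr0 sin0 mul0r subrr subr0 subr_ge0; apply.
- move=> t _; apply: (@is_derive_eq _ _ _ (@sin R - id * @cos R)).
  by rewrite /GRing.scale /=; ring.
- by apply: continuous_subspaceT => t; exact: cvg_cst.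
- apply: continuous_subspaceT => t.
  apply: cvgB; first exact: continuous_sin.
  by apply: cvgM; [exact: cvg_id|exact: continuous_cos].
- move=> t; rewrite in_itv /= => /andP[t0 tx].
  have pi0 := pi_gt0 R.
  by apply: mulr_ge0; [exact: ltW|apply: sin_ge0_pi; apply/andP; split; lra].
Qed.

(** With [u = pi * y / 2 <= pi / 4] one has [cos u ^+ 2 >= 1 / 2], so [sin (2 u) = 2 sin u cos u >=
    2 u cos^2 u >= u >= y]. *)
Lemma sin_pi_ge (y : R) : 0 <= y -> y <= 1 / 2 -> y <= sin (pi * y).
Proof.
move=> y0 y1; have pi2 := pi_ge2 R; have pi0 := pi_gt0 R.
set u := pi * y / 2.
have u0 : 0 <= u by rewrite /u; apply: mulr_ge0 => //; apply: mulr_ge0 => //; exact: ltW.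
have upi4 : u <= pi / 4 by rewrite /u; nra.
have -> : pi * y = u *+ 2 by rewrite /u -[RHS]mulr_natr; field.
have c2 : 1 / 2 <= cos u ^+ 2.
  have : 0 <= cos (u *+ 2) by apply: cos_ge0_pihalf; apply/andP; split; rewrite -mulr_natr; lra.
  by rewrite cos_mulr2n -mulr_natr; lra.
rewrite sin_mulr2n -mulr_natr.
have cu : 0 <= cos u by apply: cos_ge0_pihalf; apply/andP; split; lra.
have su := sin_ge_mul_cos u0 (_ : u <= pi / 2).
have {}su : u * cos u <= sin u by apply: su; lra.
have h : u * cos u ^+ 2 <= cos u * sin u by rewrite expr2 mulrA mulrC ler_wpM2l.
have yu : y <= u by rewrite /u; nra.
nra.
Qed.

End Derivatives.

Section Circle.
Variable R : realType.
Local Notation C := R[i].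
Implicit Types x y : R.

Lemma cisD x y : cis (x + y) = cis x * cis y.
Proof. by rewrite /cis cosD sinD; apply/eqP; rewrite eq_complex /= eqxx addrC eqxx. Qed.

Lemma cis0 : cis 0 = 1 :> C.
Proof. by rewrite /cis cos0 sin0. Qed.

Lemma e2piD x y : e2pi (x + y) = e2pi x * e2pi y.
Proof. by rewrite /e2pi mulrDr cisD. Qed.

Lemma e2pi0 : e2pi 0 = 1 :> C.
Proof. by rewrite /e2pi mulr0 cis0. Qed.

Lemma e2piMn n x : e2pi (n%:R * x) = e2pi x ^+ n.
Proof.
elim: n => [|n IH]; first by rewrite mul0r e2pi0.
by rewrite -add1n natrD mulrDl mul1r e2piD IH exprS.
Qed.

Lemma e2pi1 : e2pi 1 = 1 :> C.
Proof. by rewrite /e2pi mulr1 mulr_natl /cis cos2pi sin2pi. Qed.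

Lemma normc_cis x : Normc.normc (cis x) = 1.
Proof. by rewrite /Normc.normc /cis cos2Dsin2 sqrtr1. Qed.

Lemma normc_ge0 (z : C) : 0 <= Normc.normc z.
Proof. by case: z => a b; exact: sqrtr_ge0. Qed.

Lemma norm_normc (z : C) : `|z| = (Normc.normc z)%:C.
Proof. by []. Qed.

Lemma norm_cis x : `|cis x| = 1 :> C.
Proof. by rewrite norm_normc normc_cis. Qed.

Lemma norm_e2pi x : `|e2pi x| = 1 :> C.
Proof. exact: norm_cis. Qed.

Lemma e2piN x : e2pi (- x) = (e2pi x)^-1.
Proof.
have nz : e2pi x != 0 by rewrite -normr_gt0 norm_e2pi.
by apply: (mulfI nz); rewrite -e2piD subrr e2pi0 divff.
Qed.

Lemma e2pi_nat n : e2pi n%:R = 1 :> C.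
Proof. by rewrite -[n%:R]mulr1 e2piMn e2pi1 expr1n. Qed.

Lemma e2pi_int (k : int) : e2pi k%:~R = 1 :> C.
Proof.
case: k => n; first by rewrite -pmulrn e2pi_nat.
by rewrite NegzE mulrNz e2piN -pmulrn e2pi_nat invr1.
Qed.

Lemma normc_cis_sub x y : Normc.normc (cis x - cis y) <= 2 * `|x - y|.
Proof.
rewrite /Normc.normc /cis /=.
rewrite -[leRHS]ger0_norm ?mulr_ge0 // -sqrtr_sqr ler_sqrt ?sqr_ge0 //.
have h1 := norm_cos_sub x y; have h2 := norm_sin_sub x y.
rewrite -[X in X ^+ 2 + _]/(_ - _) -[X in _ + X ^+ 2]/(_ - _).
rewrite -(real_normK (num_real (cos x - cos y))) -(real_normK (num_real (sin x - sin y))).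
have n1 := normr_ge0 (cos x - cos y); have n2 := normr_ge0 (sin x - sin y).
nra.
Qed.

Definition nint x : int := Num.floor (x + 1 / 2).
(** The distance to the nearest integer through an explicit integer attaining it, unlike the infimum
    in [dist_int]. *)
Definition dint x : R := `|x - (nint x)%:~R|.

Lemma dint_le_half x : dint x <= 1 / 2.
Proof.
rewrite /dint /nint; have := floor_itv (x + 1 / 2); move=> /andP[h1 h2].
move: h2; rewrite intrD => h2; rewrite ler_norml; apply/andP; split; lra.
Qed.

Lemma dint_le x (k : int) : dint x <= `|x - k%:~R|.
Proof.
have h := dint_le_half x; have [->//|nk] := eqVneq k (nint x).
have : 1 <= `|k%:~R - (nint x)%:~R| :> R.
  by rewrite -intrB -intr_norm -[1]/(1%:~R) ler_int -gtz0_ge1 normr_gt0 subr_eq0.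
have -> : k%:~R - (nint x)%:~R = (x - (nint x)%:~R) - (x - k%:~R) :> R by ring.
move=> h1; have := ler_normB (x - (nint x)%:~R) (x - k%:~R); rewrite -/(dint x); lra.
Qed.

Lemma normc_1_sub_e2pi_sqr x :
  Normc.normc (1 - e2pi x) ^+ 2 = 2 - 2 * cos (2 * pi * x).
Proof.
rewrite /e2pi /cis /Normc.normc /= sqr_sqrtr ?addr_ge0 ?sqr_ge0 //.
have := cos2Dsin2 (2 * pi * x); set c := cos _; set s := sin _ => E.
by rewrite sub0r sqrrN -(addrK (c ^+ 2) (s ^+ 2)) [s ^+ 2 + _]addrC E; ring.
Qed.

(** The modulus equals [2 sin (pi * dint x)], to which [sin_pi_ge] applies. *)
Lemma dint_le_normc x : 2 * dint x <= Normc.normc (1 - e2pi x).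
Proof.
have -> : e2pi x = e2pi (x - (nint x)%:~R) by rewrite e2piD -mulrNz e2pi_int mulr1.
have h := dint_le_half x; have := normr_ge0 (x - (nint x)%:~R); rewrite -/(dint x) => h0.
rewrite -(@ler_pXn2r _ 2) ?nnegrE ?mulr_ge0 ?normc_ge0 //.
rewrite normc_1_sub_e2pi_sqr -cos_norm !normrM [`|2|]ger0_norm // [`|pi|]ger0_norm ?pi_ge0 //.
rewrite -/(dint x).
have := sin_pi_ge h0 h; set d := dint x.
have -> : 2 * pi * d = (pi * d) *+ 2 by rewrite -[RHS]mulr_natr; ring.
rewrite cos_mulr2n cos2sin2 => s.
have : d * d <= sin (pi * d) * sin (pi * d) by exact: ler_pM.
rewrite -[_ *+ 2]mulr_natr expr2 => ?.
by nra.
Qed.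

Lemma irrational_ratr (t : R) (q : rat) : irrational t -> t <> ratr q.
Proof. by move=> it e; apply: it; rewrite /rational e; exists q. Qed.

Lemma dint_eq0 x : dint x = 0 -> x = (nint x)%:~R.
Proof. by move=> /eqP; rewrite normr_eq0 subr_eq0 => /eqP. Qed.

Lemma irrational_mulrn (t : R) (n : nat) (k : int) : irrational t ->
  (0 < n)%N -> n%:R * t - k%:~R != 0.
Proof.
move=> it n0; apply/eqP => /eqP; rewrite subr_eq0 => /eqP e.
apply: (@irrational_ratr t (k%:~R / n%:R) it).
have nz : n%:R != 0 :> R by rewrite pnatr_eq0 -lt0n.
by apply: (mulfI nz); rewrite e rmorphM fmorphV /= ratr_int ratr_nat mulrC divfK.
Qed.

Lemma e2pi_eq1 x : e2pi x = 1 -> x = (nint x)%:~R.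
Proof.
move=> e; apply: dint_eq0; apply/le_anti; rewrite normr_ge0 andbT.
by have := dint_le_normc x; rewrite e subrr Normc.normc0 pmulr_rle0.
Qed.

End Circle.

(** * Gelfond's lower bound *)

Section Taylor.
Variable R : realType.
Local Notation C := R[i].

(** The right side has the shape of the coefficients [cos_coeff] and [sin_coeff]. *)
Lemma imaginary_expr (y : R) (p : nat) :
  (0 +i* y : C) ^+ p =
  ((~~ odd p)%:R * (-1) ^+ p./2 * y ^+ p) +i* ((odd p)%:R * (-1) ^+ p.-1./2 * y ^+ p).
Proof.
have even q : (0 +i* y : C) ^+ q.*2 = ((-1) ^+ q * y ^+ q.*2)%:C.
  rewrite -mul2n !exprM.
  have -> : (0 +i* y : C) ^+ 2 = (- y ^+ 2)%:C.
    by rewrite expr2; simpc; rewrite expr2.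
  by rewrite -rmorphXn /= [(- y ^+ 2) ^+ q]exprNn.
rewrite -[in LHS](odd_double_half p); case: (boolP (odd p)) => op /=.
  rewrite add1n exprS even.
  have -> : p.-1./2 = p./2 by case: p op => //= p; rewrite uphalf_half => /negPf ->.
  have -> : y ^+ p = y * y ^+ p./2.*2.
    by rewrite -exprS -[in LHS](odd_double_half p) op.
  by apply/eqP; rewrite eq_complex /=; apply/andP; split; apply/eqP; ring.
rewrite add0n even !mul0r mul1r /=.
by have -> : y ^+ p = y ^+ p./2.*2 by rewrite -[in LHS](odd_double_half p) (negPf op).
Qed.

(** The Taylor polynomial at 0 of the entire function [exp(i w z)] of [z]. *)
Definition cis_poly (J : nat) (w : R) : {poly C} :=
  \poly_(p < J) ((0 +i* w : C) ^+ p / p`!%:R).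

Lemma cis_poly_coef_near (y : R) (eta : R) : 0 < eta ->
  \forall J \near \oo,
    Normc.normc (cis y - \sum_(p < J) ((0 +i* y : C) ^+ p / p`!%:R)) <= eta.
Proof.
move=> eta0.
have E J : \sum_(p < J) ((0 +i* y : C) ^+ p / p`!%:R) =
    series (cos_coeff y) J +i* series (sin_coeff y) J.
  rewrite /series /= !big_mkord.
  elim: J => [|J IH]; first by rewrite !big_ord0.
  rewrite !big_ord_recr /= IH imaginary_expr.
  have -> : (J`!%:R : C)^-1 = (J`!%:R^-1 : R)%:C by rewrite fmorphV rmorph_nat.
  by apply/eqP; rewrite eq_complex /= !mulr0 subr0 add0r !eqxx.
have e2 : 0 < eta / 2 by rewrite divr_gt0.
have cc := @is_cvg_series_cos_coeff R y; have cs := @is_cvg_series_sin_coeff R y.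
have {cc} : series (cos_coeff y) @ \oo --> cos y by rewrite cos.unlock.
have {cs} : series (sin_coeff y) @ \oo --> sin y by rewrite sin.unlock.
move=> /cvgrPdist_le/(_ _ e2) nears /cvgrPdist_le/(_ _ e2) nearc.
near=> J; rewrite E /cis.
have hs : `|sin y - series (sin_coeff y) J| <= eta / 2 by near: J.
have hc : `|cos y - series (cos_coeff y) J| <= eta / 2 by near: J.
rewrite /Normc.normc /= -[leRHS]ger0_norm ?(ltW eta0) // -sqrtr_sqr ler_sqrt ?sqr_ge0 //.
rewrite -(real_normK (num_real (cos y - _))) -(real_normK (num_real (sin y - _))).
have n1 := normr_ge0 (cos y - series (cos_coeff y) J).
have n2 := normr_ge0 (sin y - series (sin_coeff y) J).
by nra.
Unshelve. all: by end_near.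
Qed.

Lemma cis_poly_near (N : nat) (z w : 'I_N -> R) (eta : R) : 0 < eta ->
  exists J, forall i j, Normc.normc (cis (w j * z i) - (cis_poly J (w j)).[(z i)%:C]) <= eta.
Proof.
move=> eta0.
have : \forall J \near \oo, forall i : 'I_N, forall j : 'I_N,
    Normc.normc (cis (w j * z i) - (cis_poly J (w j)).[(z i)%:C]) <= eta.
  apply: filter_forall => i; apply: filter_forall => j.
  have := cis_poly_coef_near (w j * z i) eta0; apply: filterS => J.
  rewrite /cis_poly horner_poly.
  congr (Normc.normc (_ - _) <= _); apply: eq_bigr => p _.
  rewrite mulrAC -exprMn; congr (_ ^+ _ / _).
  by apply/eqP; rewrite eq_complex /=; apply/andP; split; apply/eqP; ring.
by move=> [J _ HJ]; exists J; apply: HJ => /=.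
Qed.

Lemma sum_exp_coeff_le (x : R) J : 0 <= x -> \sum_(p < J) x ^+ p / p`!%:R <= expR x.
Proof.
move=> x0; have := @nondecreasing_cvgn_le R (series (exp_coeff x)).
move=> /(_ _ (@is_cvg_series_exp_coeff R x) J); rewrite /series /= big_mkord; apply.
by apply/nondecreasing_seqP => n; rewrite /series /= big_nat_recr //= lerDl exp_coeff_ge0.
Qed.

Lemma expR1_le4 : expR 1 <= 4 :> R.
Proof.
have h : 1 / 2 <= expR (- (1 / 2)) :> R by have := @expR_ge1Dx R (- (1 / 2)); lra.
have e : expR (- (1 / 2)) * expR (1 / 2) = 1 :> R.
  by rewrite -expRD addNr expR0.
have g : 0 <= expR (1 / 2) :> R by exact: expR_ge0.
have u : expR (1 / 2) <= 2 :> R by nra.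
have -> : 1 = 1 / 2 + 1 / 2 :> R by field.
rewrite expRD; nra.
Qed.

Lemma norm_imaginary (w : R) : `|0 +i* w : C| = `|w|%:C.
Proof.
by rewrite norm_normc /Normc.normc expr0n add0r sqrtr_sqr.
Qed.

(** The coefficients are dominated by those of [exp(|w| z)], so the bound does not depend on the
    truncation; 4 stands for [e] to keep the bounds integral. *)
Lemma cis_poly_majorant J J' (w B : R) (S : nat) : 0 <= B -> `|w| * B <= S%:R ->
  \sum_(p < J') `|(cis_poly J w)`_p| * B%:C ^+ p <= (4 ^ S)%:R.
Proof.
move=> B0 wBS.
apply: (@le_trans _ _ (\sum_(p < J') (`|w| * B) ^+ p / p`!%:R)%:C).
  rewrite rmorph_sum; apply: ler_sum => p _.
  rewrite coef_poly; case: ifP => _; last first.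
    by rewrite normr0 mul0r ler0c divr_ge0 // exprn_ge0 // mulr_ge0.
  rewrite normrM normrX normfV normr_nat norm_imaginary.
  by rewrite !rmorphM rmorphXn fmorphV rmorph_nat rmorphM exprMn mulrAC.
rewrite -(rmorph_nat (real_complex R)) lecR.
apply: le_trans (sum_exp_coeff_le _ _) _; first by rewrite mulr_ge0.
apply: (@le_trans _ _ (expR S%:R)); first by rewrite ler_expR.
rewrite -[S%:R]mulr1 expRM_natl natrX lerXn2r ?nnegrE ?expR_ge0 //.
exact: expR1_le4.
Qed.

End Taylor.

(** * Upper bound for the interpolation determinant *)

Section DetBound.
Variable R : realType.
Local Notation C := R[i].

Lemma sum_coefXnM_norm (F : numDomainType) (p : {poly F}) (k J : nat) (c B : F) :
  \sum_(q < k + J) `|(c *: ('X^k * p))`_q| * B ^+ q =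
  `|c| * B ^+ k * \sum_(q < J) `|p`_q| * B ^+ q.
Proof.
rewrite big_split_ord /= big1 ?add0r => [|q _]; last first.
  by rewrite coefZ coefXnM ltn_ord mulr0 normr0 mul0r.
rewrite mulr_sumr; apply: eq_bigr => q _.
rewrite coefZ coefXnM ltnNge leq_addr /= addKn normrM exprD; ring.
Qed.

Lemma fact_le_expn m : (m`! <= m ^ m)%N.
Proof.
rewrite fact_prod -[X in (_ <= _ ^ X)%N](subn1 m.+1) -prod_nat_const_nat.
rewrite big_nat_cond [leqRHS]big_nat_cond.
by apply: leq_prod => i /andP[/andP[_ +] _].
Qed.

Lemma natr_complex (m : nat) : (m%:R : C) = (m%:R : R)%:C.
Proof. by rewrite rmorph_nat. Qed.

Lemma norm_complex_of_real (r : R) : `|r%:C| = `|r|%:C :> C.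
Proof. by rewrite norm_normc -[r%:C]/(r +i* 0) /Normc.normc expr0n addr0 sqrtr_sqr. Qed.

(** Passing from [y i j] to exponentials, and from these to their Taylor polynomials, costs [eta]
    each time; this gives the second term. The determinant of the polynomials is bounded by
    [interpolation_det_le] with [E = 2]. *)
Lemma monomial_det_le (n K L rho N : nat) (x : 'I_N -> R) (k l : 'I_N -> nat)
    (y : 'I_N -> 'I_N -> C) (eta : R) :
  (0 < n)%N -> (0 < K)%N -> (0 < rho)%N -> (0 < N)%N -> (N <= 2 * n * rho)%N ->
  (forall i, `|x i| <= n%:R * rho%:R) -> (forall j, k j <= K)%N -> (forall j, l j <= L)%N ->
  0 < eta -> eta <= 1 ->
  (forall i j, `|y i j| <= 1) ->
  (forall i j, Normc.normc (y i j - e2pi ((l j)%:R * (x i / n%:R))) <= eta) ->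
  (2 ^ 'C(N, 2))%:R * `|\det (\matrix_(i, j) ((x i)%:C ^+ k j * y i j))| <=
  ((2 * n * rho) ^ (2 * K * N) * 2 ^ (32 * L * rho * N))%:R +
  (2 ^ 'C(N, 2) * (2 * n * rho) ^ (4 * K * N))%:R * (2 * eta)%:C :> C.
Proof.
move=> n0 K0 rho0 N0 NY xrho kK lL eta0 eta1 y1 yeta.
set Y := (2 * n * rho)%N; have Y0 : (0 < Y)%N by rewrite /Y !muln_gt0 n0.
have nzn : n%:R != 0 :> R by rewrite pnatr_eq0 -lt0n.
have [J HJ] := @cis_poly_near R N (fun i => x i / n%:R) (fun j => 2 * pi * (l j)%:R) eta eta0.
(* The factor [n ^ k j] undoes the scaling [z i = x i / n], which brings the points into the disc of
   radius [rho]. *)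
pose f j : {poly C} := ((n ^ k j)%:R : C) *: ('X^(k j) * cis_poly J (2 * pi * (l j)%:R)).
pose z i : C := (x i / n%:R)%:C.
pose P := \matrix_(i, j) (f j).[z i].
set A := \matrix_(i, j) _.
have fz i j : (f j).[z i] = (x i)%:C ^+ k j * (cis_poly J (2 * pi * (l j)%:R)).[z i].
  rewrite /f hornerZ hornerM hornerXn mulrA; congr (_ * _).
  by rewrite natrX -exprMn /z natr_complex -rmorphM mulrC divfK.
have xK i j : `|(x i)%:C ^+ k j| <= ((n * rho) ^ K)%:R :> C.
  rewrite normrX norm_complex_of_real natr_complex -rmorphXn lecR natrX.
  apply: (@le_trans _ _ ((n * rho)%:R ^+ k j)).
    by rewrite lerXn2r ?nnegrE // natrM.
  by rewrite -!natrX ler_nat leq_pexp2l // muln_gt0 n0.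
have dA i j : `|A i j - P i j| <= (Y ^ K)%:R * (2 * eta)%:C.
  rewrite !mxE fz -mulrBr normrM; apply: ler_pM => //.
    by apply: (le_trans (xK i j)); rewrite ler_nat leq_exp2r // /Y -mulnA leq_pmull.
  rewrite norm_normc lecR.
  apply: le_trans (_ : eta + eta <= _); last by lra.
  apply: le_trans (lerD (yeta i j) (HJ i j)).
  rewrite /e2pi mulrA -/(z i); set u := cis _; set v := _.[_].
  have -> : y i j - v = (y i j - u) + (u - v) by ring.
  exact: le_normcD.
have A1 i j : `|A i j| <= (Y ^ K)%:R.
  rewrite mxE normrM -[leRHS]mulr1; apply: ler_pM => //.
  by apply: (le_trans (xK i j)); rewrite ler_nat leq_exp2r // /Y -mulnA leq_pmull.
have P1 i j : `|P i j| <= (Y ^ K)%:R.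
  rewrite mxE fz normrM.
  have v2 : `|(cis_poly J (2 * pi * (l j)%:R)).[z i]| <= 2.
    have := HJ i j; set v := _.[_]; set u := cis _ => h.
    have -> : v = u - (u - v) by ring.
    apply: le_trans (ler_normB _ _) _; rewrite norm_cis (_ : 2 = 1 + 1) // lerD2l.
    rewrite norm_normc (_ : 1 = (1 : R)%:C) // lecR; exact: le_trans eta1.
  apply: le_trans (ler_pM _ _ (xK i j) v2) _ => //.
  rewrite -natrM ler_nat /Y -mulnA [((2 * _) ^ K)%N]expnMn mulnC leq_mul2r; apply/orP; right.
  by rewrite -{1}[2%N]expn1 leq_pexp2l.
have YK1 : 1 <= (Y ^ K)%:R :> C by rewrite ler1n expn_gt0 Y0.
have e0 : 0 <= (Y ^ K)%:R * (2 * eta)%:C :> C.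
  by rewrite mulr_ge0 // (_ : 0 = (0 : R)%:C) // lecR mulr_ge0 // ltW.
have dd := norm_det_sub_le YK1 e0 A1 P1 dA.
have E2 : 1 <= 2 :> C by rewrite ler1n.
have szf j : (size (f j) <= K + J)%N.
  apply: leq_trans (size_scale_leq _ _) _.
  apply: leq_trans (size_polyMleq _ _) _; rewrite size_polyXn addSn /=.
  by rewrite leq_add // size_poly.
have zrho i : `|z i| <= rho%:R.
  rewrite norm_complex_of_real natr_complex lecR normrM normfV normr_nat.
  by rewrite ler_pdivrMr ?ltr0n // mulrC.
have id := interpolation_det_le E2 (ler0n _ rho) zrho szf.
have NYK : (N <= Y ^ (K * N))%N.
  by apply: (leq_trans NY); rewrite -/Y -{1}[Y]expn1 leq_pexp2l // muln_gt0 K0.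
have NfY : (N`! <= Y ^ (K * N))%N.
  apply: (@leq_trans (N ^ N)%N).
    exact: fact_le_expn.
  apply: (@leq_trans (Y ^ N)%N); first by rewrite leq_exp2r.
  by rewrite leq_pexp2l // leq_pmull.
have majf j : \sum_(p < K + J) `|(f j)`_p| * (2 * rho%:R) ^+ p <= (Y ^ K * 2 ^ (32 * L * rho))%:R.
  have -> : (K + J = k j + (K - k j + J))%N by rewrite addnA subnKC.
  rewrite sum_coefXnM_norm natrM; apply: ler_pM; rewrite ?mulr_ge0 ?sumr_ge0 //.
    rewrite normr_nat -!natrM -natrX -natrM ler_nat -expnMn.
    rewrite (_ : n * (2 * rho) = Y)%N; last by rewrite /Y; lia.
    by rewrite leq_pexp2l.
  have -> : (2 * rho%:R : C) = (2 * rho%:R)%:C.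
    by rewrite -natrM natr_complex natrM.
  (* Here [|2 pi l| * 2 rho <= 16 L rho], as [pi <= 4], and [4 ^ (16 L rho) = 2 ^ (32 L rho)]. *)
  rewrite -mulnA (_ : 32 = 2 * 16)%N // -!mulnA expnM.
  apply: cis_poly_majorant; first by rewrite mulr_ge0.
  rewrite !normrM !normr_nat [`|pi|]ger0_norm ?pi_ge0 // !natrM.
  have pi4 : pi <= 4 :> R by have := @pihalf_lt2 R; lra.
  have lL' : (l j)%:R <= L%:R :> R by rewrite ler_nat.
  have h : pi * (l j)%:R <= 4 * L%:R :> R by apply: ler_pM => //; exact: pi_ge0.
  have := ler_wpM2r (ler0n R rho) h; lra.
have id2 : (2 ^ 'C(N, 2))%:R * `|\det P| <= (Y ^ (2 * K * N) * 2 ^ (32 * L * rho * N))%:R.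
  rewrite natrX; apply: (le_trans id).
  apply: (@le_trans _ _ ((Y ^ (K * N))%:R * \prod_(j < N) (Y ^ K * 2 ^ (32 * L * rho))%:R)).
    apply: ler_pM => //; first by apply: prodr_ge0 => j _; apply: sumr_ge0 => p _;
      rewrite mulr_ge0 // exprn_ge0 // mulr_ge0.
      by rewrite ler_nat.
    apply: ler_prod => j _; rewrite majf andbT; apply: sumr_ge0 => p _.
    by rewrite mulr_ge0 // exprn_ge0 // mulr_ge0.
  rewrite prodr_const card_ord -natrX -natrM ler_nat.
  by rewrite expnMn -!expnM mulnA -expnD addnn -mul2n !mulnA.
apply: (@le_trans _ _ ((2 ^ 'C(N, 2))%:R * (`|\det P| + `|\det A - \det P|))).
  rewrite ler_wpM2l //; apply: le_trans (ler_normD _ _).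
  by rewrite addrCA subrr addr0.
rewrite mulrDr lerD // natrM -mulrA ler_wpM2l //.
apply: (le_trans dd); rewrite !mulrA ler_wpM2r //.
  by rewrite (_ : 0 = (0 : R)%:C) // lecR mulr_ge0 // ltW.
rewrite -natrX -!natrM ler_nat -expnM.
(* The four copies of [Y ^ (K * N)] bound N!, [N], the power of [Y ^ K] in [norm_det_sub_le], and
   the [Y ^ K] in the entrywise error. *)
rewrite (_ : 4 * K * N = K * N + K * N + K * N + K * N)%N; last by lia.
rewrite !expnD leq_mul // ?leq_pexp2l // ?leq_pmulr //.
by rewrite leq_mul // leq_mul.
Qed.

End DetBound.

(** Put [m = 2 M] and [u = t %/ m + 1]. Once [u >= c m], one has
    [c (m u) ^ M <= (c m u) ^ M <= u ^ m], and [u <= 2 ^ (t %/ m)]. *)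
Lemma poly_le_exp2 (c M : nat) : (0 < M)%N -> (0 < c)%N ->
  exists t0, forall t, (t0 <= t)%N -> (c * t.+1 ^ M <= 2 ^ t)%N.
Proof.
move=> M0 c0; pose m := (2 * M)%N; have m0 : (0 < m)%N by rewrite muln_gt0.
exists (c * m * m)%N => t t0; pose u := (t %/ m).+1.
have tu : (t.+1 <= m * u)%N by rewrite mulnC /u ltn_ceil.
have uc : (c * m <= u)%N by rewrite /u leqW // leq_divRL.
apply: (@leq_trans (u ^ m)%N).
  apply: (@leq_trans (c ^ M * (m * u) ^ M)%N).
    by rewrite leq_mul ?leq_exp2r // -[X in (X <= _)%N]expn1 leq_pexp2l.
  by rewrite -expnMn /m expnM leq_exp2r // mulnA expnS expn1 leq_mul2r uc orbT.
apply: (@leq_trans ((2 ^ (t %/ m)) ^ m)%N); first by rewrite leq_exp2r // /u ltn_expl.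
by rewrite -expnM leq_pexp2l // leq_divM.
Qed.

(** The determinant is sized by the integer fifth root [t] of [n]: the losses are of order
    [2 ^ (B t ^ 4)], negligible against [exp(eps n)]. *)
Lemma root5_bounds (n : nat) : exists t, (t ^ 5 <= n < t.+1 ^ 5)%N.
Proof.
have ex : exists t, (t ^ 5 <= n)%N by exists 0%N.
have bd t : (t ^ 5 <= n)%N -> (t <= n)%N.
  by apply: leq_trans; case: t => // t; rewrite -{1}[t.+1]expn1 leq_pexp2l.
case: (ex_maxnP ex bd) => t tn maxt; exists t; rewrite tn ltnNge.
by apply/negP => /maxt; rewrite ltnn.
Qed.

(** * Lower bound for the determinant, and the choice of parameters *)

Section Gelfond.
Variable R : realType.
Local Notation C := R[i].

(** Leibniz's formula makes the determinant a sum over permutations of integer multiples of powers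
    of [a], to which the Liouville bound in the first hypothesis applies. *)
Lemma monomial_det_ge (a : C) (w d : nat) (K L P X N : nat) (x : 'I_N -> int)
    (k l r : 'I_N -> nat) :
  (forall (I : finType) (c : I -> int) (n : I -> nat) (D H : nat),
      (forall i, n i <= D)%N -> \sum_i `|c i| <= H%:R ->
      \sum_i (c i)%:~R * a ^+ n i != 0 ->
      1 <= (w ^ D.+1 * H ^ d)%:R * `|\sum_i (c i)%:~R * a ^+ n i|) ->
  (0 < X)%N -> (forall i, `|x i| <= X%:R) ->
  (forall j, k j <= K)%N -> (forall j, l j <= L)%N -> (forall i, r i <= P)%N ->
  let D := \det (\matrix_(i, j) ((x i)%:~R ^+ k j * a ^+ (r i * l j))) in
  D != 0 ->
  1 <= (w ^ (N * (P * L)).+1 * (N`! * X ^ (K * N)) ^ d)%:R * `|D| :> C.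
Proof.
move=> LV X0 xX kK lL rP /=; set D := \det _.
have -> : D = \sum_(s : 'S_N) ((-1) ^+ s * \prod_i x i ^+ k (s i))%:~R *
    a ^+ (\sum_i r i * l (s i)).
  apply: eq_bigr => s _; rewrite rmorphM rmorphXn rmorphN1 rmorph_prod -mulrA.
  congr (_ * _); rewrite -prodrXr -big_split /=; apply: eq_bigr => i _.
  by rewrite mxE rmorphXn.
apply: LV.
  move=> s; apply: (@leq_trans (\sum_(i < N) P * L)%N).
    by apply: leq_sum => i _; rewrite leq_mul.
  by rewrite sum_nat_const card_ord.
rewrite natrM mulr_natl -sum_perm_const; apply: ler_sum => s _.
rewrite normrM normrX normrN1 expr1n mul1r normr_prod expnM natrX.
rewrite -[N in leRHS]card_ord -prodr_const; apply: ler_prod => i _.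
rewrite normr_ge0 normrX natrX /=.
apply: (@le_trans _ _ (X%:R ^+ k (s i))); first by rewrite lerXn2r ?nnegrE.
by rewrite ler_weXn2l // ler1n.
Qed.

Lemma algebraic_int_root (z : C) : algebraicOver (ratr : rat -> C) z ->
  exists2 q : {poly int}, q != 0 & root (map_poly intr q) z.
Proof.
case=> p nzp rp; have [q [a nza ep]] := rat_poly_scale p.
exists q; first by apply: contra_neq nzp => q0; rewrite ep q0 map_poly0 scaler0.
move: rp; rewrite ep map_polyZ /= rootZ; last first.
  by rewrite fmorph_eq0 invr_eq0 intr_eq0.
rewrite -map_poly_comp; congr (root _ z); apply: eq_map_poly => m /=.
by rewrite ratr_int.
Qed.

(* Parameters of the interpolation determinant: [t ^ 5 <= n], [A] is large in
   terms of the degree and height of [e2pi theta] (through [w], [d]) and of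
   [th >= `|theta| + 1], and [Y] bounds all the integers [n (r m + s n)]; the
   power of [Y] being at most [2 ^ t] makes its logarithm negligible. *)
Lemma gelfond_parameters (w d th : nat) (t n : nat)
    (A := (4 * (3 * w + 96 * th + 3))%N) (Y := (2 * n * (3 * A * th * t))%N)
    (L := t) (T := (A * t)%N) (K := (A * A * t)%N) (N := (K * L)%N) :
  (0 < th)%N -> (A <= t)%N ->
  (Y ^ ((2 * d + 4) * (A * A)) <= 2 ^ t)%N ->
  (2 * (w ^ (N * ((L + T) * L)).+1 * (Y ^ (2 * K * N)) ^ d *
     (Y ^ (2 * K * N) * 2 ^ (32 * L * (3 * A * th * t) * N))) <= 2 ^ 'C(N, 2))%N /\
  (w ^ (N * ((L + T) * L)).+1 * (Y ^ (2 * K * N)) ^ d * Y ^ (4 * K * N) <=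
     2 ^ ((3 * A * w + 1) * (A * A) * t ^ 4))%N.
Proof.
move=> th0 At YQ.
have A12 : (12 <= A)%N by rewrite /A; lia.
have t0 : (0 < t)%N by lia.
have N0 : (0 < N)%N by rewrite /N /K /L !muln_gt0; lia.
have KN0 : (0 < K * N)%N by rewrite muln_gt0 N0 /K !muln_gt0; lia.
have EN : N = (A * A * t * t)%N by [].
have wD : (w ^ (N * ((L + T) * L)).+1 <= 2 ^ (3 * A * w * (t * t * N)))%N.
  apply: (@leq_trans ((2 ^ w) ^ (N * ((L + T) * L)).+1)%N).
    by rewrite leq_exp2r // ltnW // ltn_expl.
  rewrite -expnM leq_pexp2l //.
  have h : ((N * ((L + T) * L)).+1 <= 3 * A * (t * t * N))%N.
    rewrite /L /T; have h1 : (1 <= t * t * N)%N by rewrite muln_gt0 N0 muln_gt0 t0.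
    have -> : (N * ((t + A * t) * t) = (1 + A) * (t * t * N))%N by ring.
    set V := (t * t * N)%N in h1 *.
    have : (V <= A * V)%N by rewrite leq_pmull //; lia.
    lia.
  apply: (leq_trans (leq_mul (leqnn w) h)).
  by rewrite (_ : w * (3 * A * (t * t * N)) = 3 * A * w * (t * t * N))%N //; ring.
(* As [K * N = (A * A) * (t * N)], this is the hypothesis on [Y] raised to the power [t * N]. *)
have Yb e : (e <= 2 * d + 4)%N -> (Y ^ (e * (K * N)) <= 2 ^ (t * t * N))%N.
  move=> le_e; have [->|Y0] := posnP Y.
    case: e le_e => [|e] _; first by rewrite mul0n expn0 expn_gt0.
    by rewrite exp0n // muln_gt0.
  apply: (@leq_trans (Y ^ ((2 * d + 4) * (K * N)))%N).
    by rewrite leq_pexp2l // leq_mul2r le_e orbT.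
  have -> : ((2 * d + 4) * (K * N) = ((2 * d + 4) * (A * A)) * (t * N))%N by rewrite /K; lia.
  by rewrite (expnM Y) -(mulnA t) (expnM 2) leq_exp2r // muln_gt0 t0.
have VN : (t * t * N = A * A * t ^ 4)%N by rewrite EN; ring.
have Yb1 := Yb (2 * d + 2)%N; have Yb2 := Yb (2 * d + 4)%N (leqnn _).
have {}Yb1 : (Y ^ ((2 * d + 2) * (K * N)) <= 2 ^ (t * t * N))%N by apply: Yb1; lia.
have E1 e : ((Y ^ (2 * K * N)) ^ d * Y ^ (e * K * N) = Y ^ ((2 * d + e) * (K * N)))%N.
  by rewrite -expnM -expnD; congr (_ ^ _)%N; ring.
split; last first.
  rewrite -mulnA E1; apply: (leq_trans (leq_mul wD Yb2)).
  rewrite -expnD leq_pexp2l // VN; lia.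
have -> : (2 * (w ^ (N * ((L + T) * L)).+1 * (Y ^ (2 * K * N)) ^ d *
     (Y ^ (2 * K * N) * 2 ^ (32 * L * (3 * A * th * t) * N))) =
   2 * (w ^ (N * ((L + T) * L)).+1 * ((Y ^ (2 * K * N)) ^ d * Y ^ (2 * K * N)) *
     2 ^ (32 * L * (3 * A * th * t) * N)))%N by ring.
rewrite E1; apply: (leq_trans (leq_mul (leqnn 2) (leq_mul (leq_mul wD Yb1) (leqnn _)))).
rewrite -!expnD -expnS leq_pexp2l //.
have -> : (32 * L * (3 * A * th * t) * N = 96 * A * th * (t * t * N))%N by rewrite /L; ring.
(* The value of [A] is chosen for this identity: the exponents of 2 then add up to at most a quarter
   of [N * N], hence to at most ['C(N, 2)]. *)
have h4 : (4 * (t * t * N * (3 * A * w + 96 * A * th + 3 * A)) = N * N)%N.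
  by rewrite {3}EN /A; ring.
have h1 : (1 <= t * t * N)%N by rewrite muln_gt0 N0 muln_gt0 t0.
have N2 : (2 <= N)%N.
  rewrite EN; apply: (@leq_trans (A * 1 * 1 * 1)%N); first by lia.
  by rewrite !leq_mul //; lia.
have hb : (N * N <= 4 * 'C(N, 2))%N.
  have := mul_bin_diag N 1; rewrite bin1 => hb.
  have : (N * N <= 2 * (N * N.-1))%N by rewrite mulnCA leq_mul2l; apply/orP; right; lia.
  by rewrite hb; lia.
rewrite -(leq_pmul2l (_ : 0 < 4)%N) //; apply: leq_trans hb; rewrite -h4 leq_pmul2l //.
set V := (t * t * N)%N in h1 *.
have h2 : (V * 2 <= V * (3 * A))%N by rewrite leq_mul2l; apply/orP; right; lia.
rewrite (_ : V * (3 * A * w + 96 * A * th + 3 * A) =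
  3 * A * w * V + 96 * A * th * V + V * (3 * A))%N; last by ring.
by move: h1 h2; move: (3 * A * w * V)%N (96 * A * th * V)%N (V * (3 * A))%N; lia.
Qed.

End Gelfond.

(** * Gelfond's theorem *)

Section GelfondBound.
Variable R : realType.
Local Notation C := R[i].

Lemma e2pi_expr_inj (theta : R) : irrational theta -> injective (fun n => e2pi theta ^+ n).
Proof.
move=> irr.
suff H i j : (i < j)%N -> e2pi theta ^+ i = e2pi theta ^+ j -> False.
  move=> i j e; case: (ltngtP i j) => // lt_ij; first by case: (H _ _ lt_ij e).
  by case: (H _ _ lt_ij (esym e)).
move=> ltij; rewrite -[in RHS](subnK (ltnW ltij)) exprD -[LHS]mul1r => e.
have nz : e2pi theta ^+ i != 0 by rewrite -normr_gt0 normrX norm_e2pi expr1n.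
have := mulIf nz e; rewrite -e2piMn => /esym/e2pi_eq1 /eqP; rewrite -subr_eq0.
by apply/negP/irrational_mulrn => //; rewrite subn_gt0.
Qed.

(** If two values agree, [n] divides [(r - r') m], hence [r - r'], which is less than [n] in
    absolute value. *)
Lemma coprime_grid_inj (n T : nat) (m : int) : coprime n `|m|%N -> (T <= n)%N -> (0 < n)%N ->
  injective (fun p : 'I_T * 'I_T => p.1%:R * m%:~R + p.2%:R * n%:R : C).
Proof.
move=> cop Tn n0 [r s] [r' s'] /= e.
have {}e : (r : int) * m + (s : int) * (n : int) = (r' : int) * m + (s' : int) * (n : int).
  apply/eqP; rewrite -(eqr_int C) !rmorphD !rmorphM /=; apply/eqP.
  exact: e.
have e2 : ((r : int) - (r' : int)) * m = ((s' : int) - (s : int)) * (n : int).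
  rewrite !mulrBl; apply/eqP; rewrite subr_eq addrAC -subr_eq opprK addrC; apply/eqP.
  by rewrite addrC e addrC.
have dv : (n %| `|(r : int) - (r' : int)|)%N.
  rewrite -(@Gauss_dvdl n _ `|m|%N) // -abszM e2 abszM absz_nat.
  by rewrite dvdn_mull.
have lr := ltn_ord r; have lr' := ltn_ord r'.
have r0 : `|(r : int) - (r' : int)|%N = 0%N.
  apply/eqP; move: dv; apply: contraTT; rewrite -lt0n => h.
  by rewrite gtnNdvd //; lia.
have er : r = r' by apply: val_inj => /=; lia.
congr (_, _) => //; apply: val_inj => /=.
move: e2; rewrite er subrr mul0r => /esym/eqP; rewrite mulf_eq0.
by case/orP => /eqP; lia.
Qed.

(** If the bound fails, put [delta = expR (- (eps * n))] and [G = 2 ^ 'C(N, 2)]. The two bounds for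
    the determinant give [G <= W P1 + 32 delta W P2 G]. By the choice of [A] the first term is at
    most [G / 2]; since [W P2 <= 2 ^ (B t ^ 4)] and [n >= t ^ 5], the second is smaller than
    [G / 2]. *)
Lemma gelfond (theta eps : R) : irrational theta ->
  algebraicOver (ratr : rat -> C) (e2pi theta) -> 0 < eps ->
  exists n0, forall (n : nat) (m : int), (n0 <= n)%N -> coprime n `|m|%N ->
    expR (- (eps * n%:R)) <= `|n%:R * theta - m%:~R|.
Proof.
move=> irr alg eps0.
have [q nzq rq] := algebraic_int_root alg.
have [w [d LV]] := liouville (norm_e2pi theta) nzq rq.
have [th th0 th_ge] : exists2 th, (0 < th)%N & `|theta| + 1 <= th%:R.
  exists (Num.bound (`|theta| + 1)).+1 => //.
  have h : 0 <= `|theta| + 1 by rewrite addr_ge0.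
  by apply: ltW; apply: (lt_trans (archi_boundP h)); rewrite ltr_nat.
pose A := (4 * (3 * w + 96 * th + 3))%N; pose Q := ((2 * d + 4) * (A * A))%N.
have par t n := @gelfond_parameters w d th t n th0; rewrite -/A in par.
have A0 : (0 < A)%N by rewrite /A muln_gt0 addnS.
clearbody A.
have Q0 : (0 < Q)%N by rewrite /Q !muln_gt0 A0 addnS.
(* Since [n < t.+1 ^ 5], [Y] is at most [6 * A * th * t.+1 ^ 6]; [t1] ensures [Y ^ Q <= 2 ^ t]. *)
have [t1 Ht1] := @poly_le_exp2 ((6 * A * th) ^ Q) (6 * Q) ltac:(by rewrite muln_gt0 Q0)
  ltac:(by rewrite expn_gt0 !muln_gt0 A0 th0).
pose B := ((3 * A * w + 1) * (A * A))%N.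
have [t2 Ht2] : exists t2 : nat, (B + 6)%:R / eps <= t2%:R.
  exists (Num.bound ((B + 6)%:R / eps)).
  by apply: ltW; apply: archi_boundP; rewrite divr_ge0 // ltW.
(* The fifth power makes [t] exceed [t1], [t2] and [A]. *)
exists ((t1 + t2 + A).+1 ^ 5)%N => n m n0n cop; rewrite leNgt; apply/negP => lam.
have [t /andP[tn nt]] := root5_bounds n.
have tgt : (t1 + t2 + A < t)%N.
  by have := leq_ltn_trans n0n nt; rewrite ltn_exp2r // ltnS.
have n_gt0 : (0 < n)%N by apply: leq_trans n0n; rewrite expn_gt0.
have t_gt0 : (0 < t)%N by exact: leq_ltn_trans tgt.
have t1t : (t1 <= t)%N by rewrite ltnW // (leq_ltn_trans _ tgt) // -addnA leq_addr.
have t2t : (t2 < t)%N by rewrite (leq_ltn_trans _ tgt) // addnAC leq_addl.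
have At : (A < t)%N by rewrite (leq_ltn_trans _ tgt) // leq_addl.
set delta := expR _ in lam.
have delta0 : 0 < delta by exact: expR_gt0.
(* The factor 64 is [2 * 16 * 2]: the approximation error [16 * delta] is doubled in
   [monomial_det_le] and must cost less than half of [G]. *)
have small : 64 * (2 ^ (B * t ^ 4))%:R * delta < 1.
  rewrite /delta expRN -ltr_pdivlMr ?invr_gt0 ?expR_gt0 // invrK mul1r.
  have -> : 64 * (2 ^ (B * t ^ 4))%:R = 2 ^+ (B * t ^ 4 + 6) :> R.
    by rewrite natrX exprD; ring.
  apply: (@le_lt_trans _ _ (expR 1 ^+ (B * t ^ 4 + 6))).
    by rewrite lerXn2r ?nnegrE ?expR_ge0 //; have := @expR_ge1Dx R 1; lra.
  rewrite -expRM_natl mulr1 ltr_expR.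
  apply: (@le_lt_trans _ _ ((B + 6)%:R * t%:R ^+ 4)).
    rewrite -natrX -natrM ler_nat mulnDl leq_add2l.
    by rewrite leq_pmulr // expn_gt0 t_gt0.
  apply: (@lt_le_trans _ _ (eps * t%:R * t%:R ^+ 4)).
    rewrite ltr_pM2r ?exprn_gt0 ?ltr0n // mulrC -ltr_pdivrMr //.
    by apply: (le_lt_trans Ht2); rewrite ltr_nat.
  by rewrite -mulrA -exprS ler_pM2l // -natrX ler_nat.
pose L := t; pose T := (A * t)%N; pose K := (A * A * t)%N; pose rho := (3 * A * th * t)%N.
pose N := (K * L)%N; pose Y := (2 * n * rho)%N.
have rho0 : (0 < rho)%N by rewrite /rho !muln_gt0 A0 th0 t_gt0.
have K0 : (0 < K)%N by rewrite /K !muln_gt0 A0 t_gt0.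
have N0 : (0 < N)%N by rewrite /N muln_gt0 K0.
have Y0 : (0 < Y)%N by rewrite /Y muln_gt0 rho0 muln_gt0 n_gt0.
have t2n' : (t ^ 2 * (1 + A) <= n)%N.
  apply: leq_trans tn; rewrite (expnD t 2 3) leq_mul2l; apply/orP; right.
  apply: (@leq_trans t) => //.
  by rewrite -{1}[t]expn1 leq_pexp2l.
have t2n : (t ^ 2 * A <= n)%N by apply: leq_trans t2n'; rewrite leq_mul2l leq_addl orbT.
have Tn : (T <= n)%N.
  by apply: leq_trans t2n; rewrite /T mulnC leq_mul2r -{1}[t]expn1 leq_pexp2l ?orbT.
have YQ : (Y ^ Q <= 2 ^ t)%N.
  apply: leq_trans (Ht1 t t1t).
  rewrite expnM -expnMn leq_exp2r // /Y /rho.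
  apply: (@leq_trans (2 * t.+1 ^ 5 * (3 * A * th * t.+1))%N); last first.
    by rewrite (_ : 2 * t.+1 ^ 5 * (3 * A * th * t.+1) = 6 * A * th * t.+1 ^ 6)%N //; ring.
  by rewrite leq_mul // leq_mul // ltnW.
have [pb1 pb2] := par t n (ltnW At) YQ.
have KLT : (K.-1 * L < T ^ 2)%N.
  rewrite (_ : T ^ 2 = K * L)%N; last by rewrite /T /K /L; ring.
  by rewrite ltn_pmul2r // prednK.
have a0 : e2pi theta != 0 :> C by rewrite -normr_gt0 norm_e2pi.
have [N' [r [s [k [l [EN' rb sb klb nzD]]]]]] :=
  monomial_minor a0 (fun i j _ _ => @e2pi_expr_inj theta irr i j)
   (coprime_grid_inj cop Tn n_gt0) KLT.
move: r s k l rb sb klb nzD; rewrite EN' -/N => r s k l rb sb klb.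
pose xi i : int := (r i : int) * m + (s i : int) * (n : int).
have Exi i : (r i)%:R * m%:~R + (s i)%:R * n%:R = (xi i)%:~R :> C.
  by rewrite /xi rmorphD !rmorphM.
under [X in \det X]eq_mx => i j do rewrite Exi.
set D := \det _ => nzD.
have mn : `|m%:~R| <= (n * th)%:R :> R.
  have -> : m%:~R = n%:R * theta - (n%:R * theta - m%:~R) by ring.
  apply: le_trans (ler_normB _ _) _.
  have d1 : delta <= 1 by rewrite /delta expR_le1 oppr_le0 mulr_ge0 // ltW.
  rewrite normrM normr_nat natrM.
  apply: (@le_trans _ _ (n%:R * (`|theta| + 1))); last by rewrite ler_wpM2l.
  have : 1 <= n%:R :> R by rewrite ler1n.
  by rewrite mulrDr mulr1 lerD2l => n1; apply: ltW; apply: (lt_le_trans lam); lra.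
have xR i : `|(xi i)%:~R| <= (n * rho)%:R :> R.
  rewrite /xi rmorphD !rmorphM /=; apply: le_trans (ler_normD _ _) _.
  rewrite !normrM !normr_nat.
  apply: (@le_trans _ _ ((L + T)%:R * (n * th)%:R + T%:R * n%:R)).
    by rewrite lerD // ler_pM // ler_nat ltnW.
  rewrite -!natrM -natrD ler_nat /rho /L /T.
  rewrite (_ : (t + A * t) * (n * th) + A * t * n = n * ((t + A * t) * th + A * t))%N; last by ring.
  rewrite leq_mul2l; apply/orP; right.
  have h1 : (A * t <= A * t * th)%N by rewrite leq_pmulr.
  have h2 : (t * th <= A * t * th)%N by rewrite leq_mul2r leq_pmull ?orbT.
  rewrite (_ : 3 * A * th * t = A * t * th + A * t * th + A * t * th)%N; last by ring.
  by rewrite leq_add // mulnDl leq_add2r.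
have xZ i : `|xi i| <= (n * rho)%:R.
  by rewrite -(ler_int R) intr_norm; have := xR i; rewrite natz -pmulrn.
have X0 : (0 < n * rho)%N by rewrite muln_gt0 n_gt0.
have low := monomial_det_ge LV X0 xZ (fun j => ltnW (klb j).1) (fun j => ltnW (klb j).2)
  (fun i => ltnW (rb i)) nzD.
rewrite -/D in low.
have eta0 : 0 < 16 * delta by rewrite mulr_gt0.
have eta1 : 16 * delta <= 1.
  have : 1 <= (2 ^ (B * t ^ 4))%:R :> R by rewrite ler1n expn_gt0.
  by move=> h; nra.
have NY : (N <= 2 * n * rho)%N.
  rewrite /N /K /L /rho.
  apply: (@leq_trans (n * A)%N).
    by rewrite (_ : A * A * t * t = t ^ 2 * A * A)%N ?leq_mul2r ?t2n ?orbT //; ring.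
  rewrite (_ : 2 * n * (3 * A * th * t) = n * A * (6 * (th * t)))%N; last by ring.
  by rewrite leq_pmulr // !muln_gt0 th0 t_gt0.
have pi4 : pi <= 4 :> R by have := @pihalf_lt2 R; lra.
have nR0 : 0 < n%:R :> R by rewrite ltr0n.
(* Up to the integer [l s], [l (r m + s n) / n] is [r l m / n]. So the arguments of [e2pi] differ by
   [r l (n theta - m) / n], where [r l <= n]; 16 bounds [4 pi]. *)
have approx i j : Normc.normc (e2pi theta ^+ (r i * l j) -
    e2pi ((l j)%:R * ((xi i)%:~R / n%:R))) <= 16 * delta.
  have -> : (l j)%:R * ((xi i)%:~R / n%:R) =
      (r i * l j)%:R * (m%:~R / n%:R) + (l j * s i)%:R :> R.
    rewrite /xi rmorphD !rmorphM /= -?pmulrn ?natrM; field.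
    by rewrite gt_eqF.
  rewrite e2piD e2pi_nat mulr1 -e2piMn /e2pi; apply: le_trans (normc_cis_sub _ _) _.
  have -> : 2 * pi * ((r i * l j)%:R * theta) - 2 * pi * ((r i * l j)%:R * (m%:~R / n%:R)) =
      2 * pi * (r i * l j)%:R * (n%:R * theta - m%:~R) / n%:R.
    by field; rewrite gt_eqF.
  rewrite !normrM normfV !normr_nat [`|pi|]ger0_norm ?pi_ge0 //.
  rewrite mulrA ler_pdivrMr // -mulrA.
  have rl : (r i * l j <= n)%N.
    apply: leq_trans t2n'; apply: (@leq_trans ((L + T) * L)%N).
      by rewrite leq_mul // ltnW // (klb j).2.
    by rewrite /L /T (_ : (t + A * t) * t = t ^ 2 * (1 + A))%N //; ring.
  have h1 : pi * (r i * l j)%:R <= 4 * n%:R :> R.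
    by apply: ler_pM; rewrite ?pi_ge0 ?ler_nat.
  have h0 : 0 <= pi * (r i * l j)%:R :> R by rewrite mulr_ge0 ?pi_ge0.
  have h2 := ler_pM h0 (normr_ge0 (n%:R * theta - m%:~R)) h1 (ltW lam).
  by lra.
have ynorm (i j : 'I_N) : `|e2pi theta ^+ (r i * l j)| <= 1 :> C.
  by rewrite normrX norm_e2pi expr1n.
have xR' i : `|(xi i)%:~R| <= n%:R * rho%:R :> R by rewrite -natrM.
have := @monomial_det_le R n K L rho N (fun i => (xi i)%:~R) k l
  (fun i j => e2pi theta ^+ (r i * l j)) (16 * delta) n_gt0 K0 rho0 N0 NY
  xR' (fun j => ltnW (klb j).1) (fun j => ltnW (klb j).2)
  eta0 eta1 ynorm approx.
under [X in \det X]eq_mx => i j do rewrite rmorph_int.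
rewrite -/D -/Y => up.
pose W := (w ^ (N * ((L + T) * L)).+1 * (Y ^ (2 * K * N)) ^ d)%N.
have HW : (w ^ (N * ((L + T) * L)).+1 * (N`! * (n * rho) ^ (K * N)) ^ d <= W)%N.
  have leqX a b e : (a <= b)%N -> (a ^ e <= b ^ e)%N.
    by case: e => // e; rewrite leq_exp2r.
  rewrite /W leq_mul2l; apply/orP; right; apply: (leqX _ _ d).
  rewrite -mulnA mul2n -addnn expnD leq_mul //; last first.
    by apply: leqX; rewrite (_ : Y = 2 * (n * rho))%N ?leq_pmull // /Y mulnA.
  apply: (leq_trans (fact_le_expn N)); apply: (@leq_trans (Y ^ N)%N).
    by rewrite leq_exp2r.
  by rewrite leq_pexp2l // leq_pmull.
set P1 := (Y ^ (2 * K * N) * _)%N in up; set P2 := (Y ^ (4 * K * N))%N in up.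
set G := (2 ^ 'C(N, 2))%N in up.
have main : G%:R <= (W * P1)%:R + G%:R * ((W * P2)%:R * (2 * (16 * delta))) :> R.
  rewrite -lecR rmorphD !rmorphM /= -!natr_complex.
  apply: (@le_trans _ _ (W%:R * (G%:R * `|D|))).
    rewrite mulrCA -[leLHS]mulr1 ler_wpM2l //; apply: (le_trans low).
    by rewrite ler_wpM2r // ler_nat.
  apply: le_trans (ler_wpM2l (ler0n _ W) up) _.
  by rewrite !natrM !rmorphM /=  le_eqVlt; apply/orP; left; apply/eqP; ring.
have g1 : 2 * (W * P1)%:R <= G%:R :> R by rewrite -natrM ler_nat; exact: pb1.
have g2 : (W * P2)%:R <= (2 ^ (B * t ^ 4))%:R :> R by rewrite ler_nat; exact: pb2.
have G0 : 0 < G%:R :> R by rewrite ltr0n /G expn_gt0.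
have g3 : (W * P2)%:R * (2 * (16 * delta)) < 1 / 2.
  have : (W * P2)%:R * delta <= (2 ^ (B * t ^ 4))%:R * delta by rewrite ler_wpM2r // ltW.
  by lra.
have g4 : G%:R * ((W * P2)%:R * (2 * (16 * delta))) < G%:R * (1 / 2) by rewrite ltr_pM2l.
by lra.
Qed.

End GelfondBound.

(** * Truncated Fourier series of the logarithm *)

Section LogApproximation.
Variable R : realType.
Implicit Types (t phi a : R).

(** The real part of a geometric sum in [t e^(i phi)], cleared of the denominator
    [|1 - t e^(i phi)|^2]. *)
Lemma sum_expr_cos t phi K :
  (1 - 2 * t * cos phi + t ^+ 2) * (\sum_(k < K) t ^+ k * cos (k.+1%:R * phi)) =
  cos phi - t - t ^+ K * cos (K.+1%:R * phi) + t ^+ K.+1 * cos (K%:R * phi).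
Proof.
elim: K => [|K IH].
  by rewrite big_ord0 mulr0 mul0r cos0 (mul1r phi); ring.
rewrite big_ord_recr /= mulrDr IH.
have -> : cos (K.+2%:R * phi) = 2 * cos phi * cos (K.+1%:R * phi) - cos (K%:R * phi).
  have -> : K%:R * phi = K.+1%:R * phi - phi by rewrite -addn1 natrD; ring.
  have -> : K.+2%:R * phi = K.+1%:R * phi + phi by rewrite -[in LHS]addn1 natrD; ring.
  by rewrite cosD cosB; ring.
by rewrite !exprS; ring.
Qed.

(** Inside the absolute value is the [t]-derivative of [log|1 - t e^(i phi)|] plus its truncated
    series. By [sum_expr_cos] it is [- t ^ K u / q], where [u] is the real part of a number of
    modulus [sqrt q]. *)
Lemma log_derivative_le t phi K : 0 <= t -> cos phi < 1 -> t < 1 ->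
  `|(t - cos phi) / (1 - 2 * t * cos phi + t ^+ 2) +
    \sum_(k < K) t ^+ k * cos (k.+1%:R * phi)| <=
  t ^+ K / Num.sqrt (1 - 2 * t * cos phi + t ^+ 2).
Proof.
move=> t0 c1 t1; set q := 1 - 2 * t * cos phi + t ^+ 2.
have q0 : 0 < q.
  have h1 : 0 <= t * (1 - cos phi) by rewrite mulr_ge0 // subr_ge0 ltW.
  have h2 : 0 < (1 - t) * (1 - t) by rewrite mulr_gt0 // subr_gt0.
  rewrite /q expr2; lra.
have nq : q != 0 by rewrite gt_eqF.
set S := \sum_(k < K) _.
have -> : (t - cos phi) / q + S = - (t ^+ K * (cos (K.+1%:R * phi) - t * cos (K%:R * phi))) / q.
  apply: (mulfI nq); rewrite mulrDr [q * S]sum_expr_cos !mulrA ![q * _]mulrC !mulfK //.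
  by rewrite exprS; ring.
rewrite mulNr normrN !normrM normfV (ger0_norm (exprn_ge0 K t0)) (gtr0_norm q0) -mulrA.
rewrite ler_wpM2l ?exprn_ge0 //.
set u := cos (K.+1%:R * phi) - t * cos (K%:R * phi).
have uq : u ^+ 2 <= q.
  have h : q = u ^+ 2 + (sin (K.+1%:R * phi) - t * sin (K%:R * phi)) ^+ 2.
    have e : cos phi = cos (K.+1%:R * phi) * cos (K%:R * phi) +
        sin (K.+1%:R * phi) * sin (K%:R * phi).
      by rewrite -cosB -mulrBl -natrB // subSnn mul1r.
    rewrite /q /u -[X in X - _](cos2Dsin2 (K.+1%:R * phi)) -[t ^+ 2]mulr1.
    by rewrite -[X in _ + _ * X](cos2Dsin2 (K%:R * phi)) e; ring.
  by rewrite h lerDl sqr_ge0.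
have sq0 : 0 < Num.sqrt q by rewrite sqrtr_gt0.
have usq : `|u| <= Num.sqrt q by rewrite -sqrtr_sqr ler_sqrt // ltW.
rewrite ler_pdivrMr // -{2}(sqr_sqrtr (ltW q0)) expr2 mulrA mulVf ?gt_eqF // mul1r //.
Qed.

(** The right side is [|1 - t e^(i phi)|^2] when [a = |1 - e^(i phi)|]. For [t <= 1/2] its first
    square suffices; otherwise compare arithmetic and geometric means. *)
Lemma log_kernel_ge t a : 0 <= t -> t <= 1 -> 0 <= a -> a <= 2 ->
  (1 - t) * a / 4 <= (1 - t) ^+ 2 + t * a ^+ 2.
Proof.
move=> t0 t1 a0 a2; have [th|th] := leP t (1 / 2).
  have h : (1 - t) * (a / 4) <= (1 - t) * (1 - t) by rewrite ler_wpM2l ?subr_ge0 //; lra.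
  have : 0 <= t * a ^+ 2 by rewrite mulr_ge0 // sqr_ge0.
  by rewrite expr2; lra.
have h : 0 <= ((1 - t) - a / 2) ^+ 2 by exact: sqr_ge0.
have h2 : 0 <= (1 - t) * a by rewrite mulr_ge0 // subr_ge0.
have h3 : 0 <= (t - 1 / 2) * a ^+ 2 by rewrite mulr_ge0 ?sqr_ge0 // subr_ge0 ltW.
have h4 : 0 <= a ^+ 2 by exact: sqr_ge0.
by rewrite !expr2 in h h3 h4 *; lra.
Qed.

(** A form of Bernoulli's inequality: [t ^ K] is replaced by a rational function whose quotient by
    [sqrt (1 - t)] has an arctangent as primitive. *)
Lemma expr_le_inv t K : 0 <= t -> t <= 1 -> t ^+ K * (1 + K%:R * (1 - t)) <= 1.
Proof.
move=> t0 t1; elim: K => [|K IH]; first by rewrite mul0r addr0 mulr1.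
apply: le_trans IH; rewrite exprS -mulrA mulrCA ler_wpM2l ?exprn_ge0 //.
have : 0 <= K%:R :> R by [].
rewrite -addn1 natrD => K0.
have h : 0 <= (1 - t) * (1 - t) * (1 + K%:R) by rewrite !mulr_ge0 ?subr_ge0 // addr_ge0.
by nra.
Qed.

Lemma log_cos_approx phi K : cos phi < 1 -> (0 < K)%N ->
  `|ln (2 - 2 * cos phi) / 2 + \sum_(k < K) cos (k.+1%:R * phi) / k.+1%:R| <=
  8 / Num.sqrt (Num.sqrt (2 - 2 * cos phi) * K%:R).
Proof.
move=> c1 K0; have cN1 := cos_geN1 phi.
set a := Num.sqrt (2 - 2 * cos phi).
have a2 : a ^+ 2 = 2 - 2 * cos phi by rewrite sqr_sqrtr //; lra.
have a0 : 0 < a by rewrite sqrtr_gt0; lra.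
have ale2 : a <= 2.
  by rewrite -(@ler_pXn2r _ 2) ?nnegrE ?(ltW a0) // a2 (_ : 2 ^+ 2 = 4); [lra|ring].
have K0' : 0 < K%:R :> R by rewrite ltr0n.
pose q t := 1 - 2 * t * cos phi + t ^+ 2.
have qE t : q t = (1 - t) ^+ 2 + t * a ^+ 2 by rewrite /q a2; ring.
have q_gt0 t : 0 <= t -> 0 < q t.
  rewrite le_eqVlt => /predU1P[<-|t0]; first by rewrite /q; lra.
  have h1 : 0 < t * (1 - cos phi) by rewrite mulr_gt0 // subr_gt0.
  have h2 := sqr_ge0 (1 - t); rewrite /q !expr2 in h2 *; lra.
pose h (k : 'I_K) (t : R) := t ^+ k.+1 * (cos (k.+1%:R * phi) / k.+1%:R).
pose D := (fun t => ln (q t) / 2) + \sum_(k < K) h k.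
pose dD t := (t - cos phi) / q t + \sum_(k < K) t ^+ k * cos (k.+1%:R * phi).
pose G t := - (4 / Num.sqrt (a * K%:R) * atan (Num.sqrt (K%:R * (1 - t)))).
pose dG t := 2 / Num.sqrt a / ((1 + K%:R * (1 - t)) * Num.sqrt (1 - t)).
have derD t : 0 <= t -> is_derive t 1 D (dD t).
  move=> t0; apply: is_deriveD.
    have dq : is_derive t 1 q (2 * (t - cos phi)).
      rewrite /q; apply: is_derive_eq.
      by rewrite /GRing.scale /=; ring.
    have dl : is_derive t 1 (@ln R \o q) ((q t)^-1 * (2 * (t - cos phi))).
      by apply: is_derive1_comp; exact: is_derive1_ln (q_gt0 t t0).
    rewrite (_ : (fun t => ln (q t) / 2) = (@ln R \o q) * cst 2^-1) //.
    apply: is_derive_eq; rewrite /GRing.scale /=.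
    by field; rewrite gt_eqF ?q_gt0.
  have dh k : is_derive t 1 (h k) (t ^+ k * cos (k.+1%:R * phi)).
    have -> : h k = (@id R ^+ k.+1) * cst (cos (k.+1%:R * phi) / k.+1%:R).
      by apply/funext => s; rewrite /h /= exprfctE.
    apply: is_derive_eq; rewrite /GRing.scale /=.
    by field; rewrite nat1r pnatr_eq0.
  exact: is_derive_sum.
have derG t : t < 1 -> is_derive t 1 G (dG t).
  move=> t1; pose g := (fun s : R => K%:R * (1 - s)).
  have g0 : 0 < g t by rewrite mulr_gt0 // subr_gt0.
  have dg : is_derive t 1 g (- K%:R).
    by rewrite /g; apply: is_derive_eq; rewrite /GRing.scale /=; ring.
  have ds : is_derive t 1 (Num.sqrt \o g) ((2 * Num.sqrt (g t))^-1 * (- K%:R)).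
    by apply: is_derive1_comp; exact: is_derive1_sqrt.
  have da : is_derive t 1 (@atan R \o (Num.sqrt \o g))
      ((1 + Num.sqrt (g t) ^+ 2)^-1 * ((2 * Num.sqrt (g t))^-1 * (- K%:R))).
    exact: is_derive1_comp.
  have -> : G = cst (- (4 / Num.sqrt (a * K%:R))) * (@atan R \o (Num.sqrt \o g)).
    by apply/funext => s; rewrite /G /= mulNr.
  apply: is_derive_eq; rewrite /GRing.scale /= /dG sqr_sqrtr ?ltW // mulr0 addr0.
  rewrite /g !sqrtrM ?(ltW a0) ?ltr0n ?ler0n //.
  have sK : Num.sqrt K%:R * Num.sqrt K%:R = K%:R :> R by rewrite -expr2 sqr_sqrtr.
  have nsK : Num.sqrt K%:R != 0 :> R by rewrite gt_eqF // sqrtr_gt0.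
  have nsa : Num.sqrt a != 0 by rewrite gt_eqF // sqrtr_gt0.
  have nst : Num.sqrt (1 - t) != 0 by rewrite gt_eqF // sqrtr_gt0 subr_gt0.
  have nk : 1 + K%:R * (1 - t) != 0 by rewrite gt_eqF // ltr_pwDl // ltW.
  have -> : - K%:R = - (Num.sqrt K%:R * Num.sqrt K%:R) :> R by rewrite sK.
  field.
  by rewrite nst nk nsa nsK.
have contD : {within `[0, 1], continuous D}.
  apply: derivable_within_continuous => t; rewrite in_itv /= => /andP[t0 _].
  by apply: ex_derive; exact: derD.
have contG : {within `[0, 1], continuous G}.
  apply: continuous_subspaceT => t; apply: cvgN; apply: cvgM; first exact: cvg_cst.
  apply: continuous_comp; last exact: continuous_atan.
  apply: continuous_comp; last exact: sqrt_continuous.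
  apply: cvgM; first exact: cvg_cst.
  by apply: cvgB; [exact: cvg_cst|exact: cvg_id].
have bnd t : t \in `]0, 1[ -> `|dD t| <= dG t.
  rewrite in_itv /= => /andP[t0 t1]; have t0' := ltW t0; have t1' := ltW t1.
  apply: (le_trans (log_derivative_le K t0' c1 t1)).
  rewrite -/(q t) /dG.
  have u0 : 0 < Num.sqrt (1 - t) by rewrite sqrtr_gt0 subr_gt0.
  have sa0 : 0 < Num.sqrt a by rewrite sqrtr_gt0.
  have Kt : 0 < 1 + K%:R * (1 - t) by rewrite ltr_pwDl // mulr_ge0 ?subr_ge0.
  have sq : Num.sqrt (1 - t) * Num.sqrt a / 2 <= Num.sqrt (q t).
    rewrite -(@ler_pXn2r _ 2) ?nnegrE ?sqrtr_ge0 ?mulr_ge0 ?sqrtr_ge0 //.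
    rewrite sqr_sqrtr ?(ltW (q_gt0 t t0')) // !exprMn !sqr_sqrtr ?subr_ge0 ?(ltW a0) //.
    by rewrite exprVn qE; have := log_kernel_ge t0' t1' (ltW a0) ale2; lra.
  have sq0 : 0 < Num.sqrt (q t) by rewrite sqrtr_gt0 q_gt0.
  have e := expr_le_inv K t0' t1'.
  have e2 : t ^+ K <= (1 + K%:R * (1 - t))^-1 by rewrite -[leRHS]mul1r ler_pdivlMr.
  rewrite ler_pdivrMr //; apply: (le_trans e2).
  have -> : 2 / Num.sqrt a / ((1 + K%:R * (1 - t)) * Num.sqrt (1 - t)) * Num.sqrt (q t) =
      (1 + K%:R * (1 - t))^-1 * (Num.sqrt (q t) / (Num.sqrt (1 - t) * Num.sqrt a / 2)).
    by field; rewrite !gt_eqF.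
  rewrite ler_pMr ?invr_gt0 // ler_pdivlMr ?mul1r //.
  by rewrite divr_gt0 // mulr_gt0.
have derD' t : t \in `]0, 1[ -> is_derive t 1 D (dD t).
  by rewrite in_itv /= => /andP[/ltW t0 _]; exact: derD.
have derG' t : t \in `]0, 1[ -> is_derive t 1 G (dG t).
  by rewrite in_itv /= => /andP[_ t1]; exact: derG.
have := norm_sub_le_of_derive ler01 _ _ contD contG bnd.
have -> : D 1 = ln (2 - 2 * cos phi) / 2 + \sum_(k < K) cos (k.+1%:R * phi) / k.+1%:R.
  rewrite /D /= fct_sumE /q; congr (ln _ / 2 + _); first by ring.
  by apply: eq_bigr => k _; rewrite /h expr1n mul1r.
have -> : D 0 = 0.
  have -> : D 0 = ln (q 0) / 2 + \sum_(k < K) h k 0 by rewrite /D fct_sumE.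
  rewrite big1 ?addr0 => [|k _]; last by rewrite /h exprS !mul0r.
  by rewrite /q mulr0 mul0r subr0 expr0n addr0 ln1 mul0r.
rewrite subr0 => H; apply: le_trans (H derD' derG') _.
rewrite /G subrr mulr0 sqrtr0 atan0 mulr0 oppr0 sub0r opprK addr0 mulr1.
have pi4 : atan (Num.sqrt K%:R) <= 2 :> R.
  apply/ltW/(lt_trans (atan_ltpi2 _)); exact: pihalf_lt2.
have c0 : 0 <= 4 / Num.sqrt (a * K%:R) by rewrite divr_ge0 // sqrtr_ge0.
apply: (le_trans (ler_wpM2l c0 pi4)).
by rewrite mulrAC -natrM.
Qed.

End LogApproximation.

(** * Best approximations *)

Section Cells.
Variable R : realType.
Implicit Types (x y theta : R).

Definition fracp x : R := x - (Num.floor x)%:~R.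

Lemma fracp_ge0 x : 0 <= fracp x.
Proof. by rewrite subr_ge0 floor_le. Qed.

Lemma fracp_lt1 x : fracp x < 1.
Proof. by have /andP[_] := floor_itv x; rewrite intrD /fracp; lra. Qed.

Lemma dint_ge_min x h : h <= fracp x -> h <= 1 - fracp x -> h <= dint x.
Proof.
move=> h0 h1; have f0 := fracp_ge0 x; have f1 := fracp_lt1 x.
have -> : dint x = `|fracp x - (nint x - Num.floor x)%:~R|.
  by rewrite /dint /fracp intrB; congr `|_|; ring.
set k : int := nint x - Num.floor x.
have [k0|k0] := lerP k 0.
  have : k%:~R <= 0 :> R by rewrite lerz0.
  by move=> ?; rewrite ger0_norm; lra.
have : 1 <= k%:~R :> R by rewrite -[1]/(1%:~R) ler_int -gtz0_ge1.
by move=> ?; rewrite ler0_norm; lra.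
Qed.

Definition cell (M : nat) x : nat := Num.truncn (M%:R * fracp x).

Lemma cell_itv M x : (cell M x)%:R <= M%:R * fracp x < (cell M x).+1%:R.
Proof. by apply: truncn_itv; rewrite mulr_ge0 // fracp_ge0. Qed.

Lemma ltn_cell M x : (0 < M)%N -> (cell M x < M)%N.
Proof.
move=> M0; rewrite /cell truncn_lt_nat ?mulr_ge0 ?fracp_ge0 //.
by rewrite -[ltRHS]mulr1 ltr_pM2l ?ltr0n // fracp_lt1.
Qed.

Lemma cell_inj M x y : (0 < M)%N -> cell M x = cell M y -> dint (x - y) < M%:R^-1.
Proof.
move=> M0 e; have /andP[h1 h2] := cell_itv M x; have /andP[h3 h4] := cell_itv M y.
rewrite e in h1 h2; have MR : 0 < M%:R :> R by rewrite ltr0n.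
apply: le_lt_trans (dint_le (x - y) (Num.floor x - Num.floor y)) _.
rewrite -[ltRHS]mul1r ltr_pdivlMr //.
have -> : x - y - (Num.floor x - Num.floor y)%:~R = fracp x - fracp y.
  by rewrite /fracp intrB; ring.
rewrite -[X in _ * X]gtr0_norm // -normrM mulrBl ![_ * M%:R]mulrC.
move: h2 h4; rewrite -addn1 natrD => h2 h4.
by rewrite ltr_norml; apply/andP; split; lra.
Qed.

(** A point of cell [h] is at distance at least [h / M] from the left end of the unit interval and
    at least [(M - h - 1) / M] from the right end. *)
Lemma cell_dint M x : (0 < M)%N ->
  (minn (cell M x) (M - (cell M x).+1))%:R / M%:R <= dint x.
Proof.
move=> M0; have /andP[h1 h2] := cell_itv M x; have lc := ltn_cell x M0.
have MR : 0 < M%:R :> R by rewrite ltr0n.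
apply: dint_ge_min; rewrite ler_pdivrMr //.
  by rewrite mulrC (le_trans _ h1) // ler_nat geq_minl.
apply: (@le_trans _ _ (M - (cell M x).+1)%:R); first by rewrite ler_nat geq_minr.
by rewrite natrB //; lra.
Qed.

(** Separated points lie in distinct cells; this serves both the block sums and the pigeonhole
    argument of [best_tends_infty]. *)
Lemma cell_ord_inj (M N n0 : nat) theta (M0 : (0 < M)%N) :
  (forall j, (0 < j < N)%N -> M%:R^-1 <= dint (j%:R * theta)) ->
  injective (fun i : 'I_N => Ordinal (ltn_cell ((n0 + i)%:R * theta) M0)).
Proof.
move=> sep; set ce := fun _ => _.
suff H (i j : 'I_N) : (i < j)%N -> ce i = ce j -> False.
  move=> i j e; case: (ltngtP i j) => [lt|lt|/val_inj //].
    by case: (H _ _ lt e).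
  by case: (H _ _ lt (esym e)).
move=> ltij /(congr1 val) /= /esym /(cell_inj M0).
rewrite -mulrBl -natrB ?leq_add2l ?(ltnW ltij) // subnDl ltNge sep //.
by rewrite subn_gt0 ltij /= (leq_ltn_trans (leq_subr _ _)).
Qed.

(** The term [h = 0] is 0, the inverse of 0 being 0. The induction step is [2 u v <= u ^ 2 + v ^ 2]
    for consecutive square roots. *)
Lemma sum_inv_sqrt_le M : \sum_(h < M.+1) (Num.sqrt h%:R)^-1 <= 2 * Num.sqrt M%:R :> R.
Proof.
elim: M => [|M IH].
  by rewrite big_ord_recr big_ord0 /= sqrtr0 invr0 add0r mulr0.
rewrite big_ord_recr /=; apply: (le_trans (lerD IH (lexx _))).
set u := Num.sqrt M%:R; set v := Num.sqrt M.+1%:R.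
have v0 : 0 < v by rewrite sqrtr_gt0 ltr0n.
have u0 : 0 <= u by exact: sqrtr_ge0.
have u2 : u ^+ 2 = M%:R by rewrite sqr_sqrtr.
have v2 : v ^+ 2 = M%:R + 1 by rewrite sqr_sqrtr // -addn1 natrD.
have vV : v * v^-1 = 1 by rewrite divff // gt_eqF.
rewrite -(ler_pM2l v0) mulrDr vV.
have := sqr_ge0 (u - v); rewrite !expr2 in u2 v2 *; lra.
Qed.

(* Each cell of width [1 / (2 q)] contains at most one point; the two cells
   touching an integer contribute [2 * big], the others a sum of
   [c / sqrt (h / (2 q))] with [h < 2 q]. *)
Lemma block_sum_le (q : nat) (theta big c : R) (F : 'I_q -> R) (n0 : nat) :
  (0 < q)%N -> 0 <= big -> 0 <= c ->
  (forall j, (0 < j < q)%N -> (2 * q)%:R^-1 <= dint (j%:R * theta)) ->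
  (forall i : 'I_q, F i <= big) ->
  (forall i : 'I_q, 0 < dint ((n0 + i)%:R * theta) ->
     F i <= c / Num.sqrt (dint ((n0 + i)%:R * theta))) ->
  \sum_i F i <= 2 * big + 8 * c * q%:R.
Proof.
move=> q0 big0 c0 sep Fbig Fc.
pose M := (2 * q)%N; have M0 : (0 < M)%N by rewrite muln_gt0.
have MR : 0 < M%:R :> R by rewrite ltr0n.
pose x (i : 'I_q) := (n0 + i)%:R * theta.
(* The bound for a point [h] cells away from an integer; at [h = 0] only [big] is left, since the
   inverse of 0 is 0. *)
pose V (h : nat) : R := (h == 0%N)%:R * big + c * Num.sqrt M%:R * (Num.sqrt h%:R)^-1.
have V0 h : 0 <= V h.
  by rewrite addr_ge0 // !mulr_ge0 // ?invr_ge0 sqrtr_ge0.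
pose ce (i : 'I_q) : 'I_M := Ordinal (ltn_cell (x i) M0).
have ce_inj : injective ce by exact: cell_ord_inj.
have FV i : F i <= V (minn (ce i) (M - (ce i).+1)).
  have := cell_dint (x i) M0; rewrite -/(nat_of_ord (ce i)).
  set h := minn _ _ => hd.
  have [h0|h0] := posnP h.
    rewrite h0 /V eqxx mul1r; apply: (le_trans (Fbig i)).
    by rewrite lerDl !mulr_ge0 // ?invr_ge0 sqrtr_ge0.
  have hM : 0 < h%:R / M%:R :> R by rewrite divr_gt0 // ltr0n.
  have dx : 0 < dint (x i) by exact: lt_le_trans hd.
  apply: (le_trans (Fc i dx)); rewrite /V (gtn_eqF h0) mul0r add0r -mulrA ler_wpM2l //.
  rewrite -[leRHS]invrK lef_pV2 ?posrE ?sqrtr_gt0 //; last first.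
    by rewrite invr_gt0 divr_gt0 // sqrtr_gt0 // ltr0n.
  by rewrite invfM invrK mulrC -sqrtrV // -sqrtrM ?ler0n // ler_sqrt // ltW.
(* The minimum is replaced by a sum over both ends, so that after reindexing every cell is counted
   twice. *)
apply: (@le_trans _ _ (\sum_(i < q) (V (ce i) + V (rev_ord (ce i))))).
  apply: ler_sum => i _; apply: (le_trans (FV i)) => /=.
  by rewrite /minn; case: ifP => _; rewrite ?lerDl ?lerDr.
apply: (@le_trans _ _ (\sum_(h < M) (V h + V (rev_ord h)))).
  rewrite -(big_imset (fun h : 'I_M => V h + V (rev_ord h)) (in2W ce_inj)) /=.
  rewrite [leRHS](bigID (fun h => h \in finset.imset ce (mem 'I_q))) /= lerDl sumr_ge0 // => h _.
  by rewrite addr_ge0.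
have revV : \sum_(h < M) V (rev_ord h) = \sum_(h < M) V h.
  by rewrite [RHS](reindex_inj rev_ord_inj).
rewrite big_split /= revV.
rewrite /V big_split /= -!mulr_suml -mulr_sumr.
have -> : \sum_(h < M) ((h : nat) == 0%N)%:R = 1 :> R.
  rewrite (bigD1 (Ordinal M0)) //= big1 ?addr0 // => h.
  by rewrite -val_eqE /= => /negPf ->.
have h1 : \sum_(h < M) (Num.sqrt h%:R)^-1 <= 2 * Num.sqrt M%:R :> R.
  have := sum_inv_sqrt_le M.-1; rewrite (prednK M0) => h; apply: (le_trans h).
  by rewrite ler_pM2l // ler_sqrt // ler_nat leq_pred.
have h2 : c * Num.sqrt M%:R * (\sum_(h < M) (Num.sqrt h%:R)^-1) <= c * (2 * M%:R).
  rewrite -mulrA ler_wpM2l //; apply: (le_trans (ler_wpM2l (sqrtr_ge0 _) h1)).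
  by rewrite mulrCA -expr2 sqr_sqrtr.
have h3 : c * (2 * M%:R) = 4 * (c * q%:R) by rewrite natrM; ring.
by lra.
Qed.

End Cells.

Section BestApproximation.
Variables (R : realType) (theta : R).
Hypothesis irr : irrational theta.

Lemma dint_gt0 n : (0 < n)%N -> 0 < dint (n%:R * theta).
Proof. by move=> n0; rewrite normr_gt0; apply: irrational_mulrn. Qed.

Definition best (N q : nat) : Prop := (0 < q <= N)%N /\
  forall n, (0 < n <= N)%N -> dint (q%:R * theta) <= dint (n%:R * theta).

Lemma best_exists N : (0 < N)%N -> exists q, best N q.
Proof.
elim: N => // -[|N] IH _.
  by exists 1%N; split => // n /andP[n0 n1]; have -> : n = 1%N by lia.
have [//|q [/andP[q0 qN] qmin]] := IH.
have [h|h] := leP (dint (q%:R * theta)) (dint (N.+2%:R * theta)).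
  exists q; split; first by rewrite q0 leqW.
  by move=> n; rewrite [(n <= _)%N]leq_eqVlt ltnS andb_orr => /orP[/andP[_ /eqP ->//]|/qmin].
exists N.+2; split; first by rewrite leqnn.
move=> n; rewrite [(n <= _)%N]leq_eqVlt ltnS andb_orr => /orP[/andP[_ /eqP ->//]|/qmin].
by apply: le_trans; exact: ltW.
Qed.

(** Dividing out a common factor [g] gives a denominator below [N] whose distance is at least [g]
    times smaller; as the distance is positive, minimality forces [g = 1]. *)
Lemma best_coprime N q : best N q -> coprime q `|nint (q%:R * theta)|%N.
Proof.
move=> [/andP[q0 qN] qmin]; set p := nint _.
pose g := gcdn q `|p|%N; have g0 : (0 < g)%N by rewrite gcdn_gt0 q0.
have [q' Eq] : exists q', q = (q' * g)%N by apply/dvdnP; exact: dvdn_gcdl.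
have [p' Ep] : exists p' : int, p = p' * (g : int).
  by apply/dvdzP; rewrite dvdzE absz_nat dvdn_gcdr.
have q'0 : (0 < q')%N by move: q0; rewrite Eq muln_gt0 => /andP[].
have q'N : (q' <= N)%N by apply: leq_trans qN; rewrite Eq leq_pmulr.
have gR : 0 < g%:R :> R by rewrite ltr0n.
have d0 := dint_gt0 q0.
have h : dint (q%:R * theta) * g%:R <= dint (q%:R * theta).
  apply: (@le_trans _ _ (dint (q'%:R * theta) * g%:R)).
    by rewrite ler_pM2r // qmin // q'0.
  apply: (@le_trans _ _ (`|q'%:R * theta - p'%:~R| * g%:R)).
    by rewrite ler_pM2r // dint_le.
  rewrite -(gtr0_norm gR) -normrM mulrBl /dint -/p Ep {1}Eq natrM intrM -pmulrn.
  by rewrite mulrAC.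
move: h; rewrite -[leRHS]mulr1 ler_pM2l // lern1.
rewrite /coprime -/g; case: (g) g0 => [|[|]] //.
Qed.

(** With [p], [t] the integers nearest to [q theta], [j theta], the integer [j p - t q] is nonzero
    by coprimality. Hence [1 <= q ||j theta|| + j ||q theta|| <= 2 q ||j theta||]. *)
Lemma best_separation N q : best N q ->
  forall j, (0 < j < q)%N -> (2 * q)%:R^-1 <= dint (j%:R * theta).
Proof.
move=> bq j /andP[j0 jq]; have cop := best_coprime bq.
have [/andP[q0 qN] qmin] := bq.
have jN : (j <= N)%N by apply: leq_trans qN; exact: ltnW.
set p := nint (q%:R * theta) in cop; set t := nint (j%:R * theta).
have nz : (j : int) * p - t * (q : int) != 0.
  rewrite subr_eq0; apply/eqP => e.
  have : (q %| j * `|p|)%N.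
    by have /(congr1 absz) := e; rewrite !abszM !absz_nat => ->; exact: dvdn_mull.
  by rewrite Gauss_dvdl // gtnNdvd.
have : 1 <= `|((j : int) * p - t * (q : int))%:~R| :> R.
  by rewrite -intr_norm -[1]/(1%:~R) ler_int -gtz0_ge1 normr_gt0.
have -> : ((j : int) * p - t * (q : int))%:~R =
    q%:R * (j%:R * theta - t%:~R) - j%:R * (q%:R * theta - p%:~R) :> R.
  by rewrite intrB !intrM -!pmulrn; ring.
move=> h1; have := ler_normB (q%:R * (j%:R * theta - t%:~R)) (j%:R * (q%:R * theta - p%:~R)).
rewrite !normrM !normr_nat -/(dint (q%:R * theta)) -/(dint (j%:R * theta)) => h2.
have h3 := qmin j (introT andP (conj j0 jN)).
have jqR : j%:R <= q%:R :> R by rewrite ler_nat ltnW.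
have h4 : j%:R * dint (q%:R * theta) <= q%:R * dint (j%:R * theta).
  by apply: ler_pM => //; exact: normr_ge0.
rewrite -[leLHS]mul1r ler_pdivrMr ?ltr0n ?muln_gt0 // natrM; lra.
Qed.

(** Pigeonhole: while [q <= Q], all distances up to [N] are at least a fixed [d > 0], so the [N]
    points occupy distinct cells of a fixed subdivision, which bounds [N]. *)
Lemma best_tends_infty Q : exists N0, forall N q, (N0 <= N)%N -> best N q -> (Q < q)%N.
Proof.
have [q0 [/andP[q0_gt0 q0Q] q0min]] := @best_exists Q.+1 isT.
set d := dint (q0%:R * theta) in q0min; have d0 : 0 < d by exact: dint_gt0.
pose M := (Num.bound d^-1).+1.
have Md : M%:R^-1 <= d.
  rewrite -[leRHS]invrK lef_pV2 ?posrE ?invr_gt0 ?ltr0n //.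
  apply: ltW; apply: lt_le_trans (archi_boundP _) _; first by rewrite invr_ge0 ltW.
  by rewrite ler_nat.
exists M.+1 => N q MN [/andP[qgt0 qN] qmin]; rewrite ltnNge; apply/negP => qQ.
have sep n : (0 < n <= N)%N -> d <= dint (n%:R * theta).
  by move=> nN; apply: le_trans (qmin _ nN); apply: q0min; rewrite qgt0 leqW.
have MRgt0 : (0 < M)%N by [].
have inj := @cell_ord_inj R M N 0 theta MRgt0.
have {}inj : injective (fun i : 'I_N => Ordinal (ltn_cell ((0 + i)%N%:R * theta) MRgt0)).
  apply: inj => j /andP[j0 jN]; apply: (le_trans Md); apply: sep.
  by rewrite j0 ltnW.
by have := leq_card _ inj; rewrite !card_ord leqNgt MN.
Qed.

End BestApproximation.

(** * Averages of the truncation error *)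

Section ErrorAverage.
Variable R : realType.
Implicit Types (x theta : R).

Definition cos_sum (K : nat) x : R := \sum_(k < K) cos (k.+1%:R * (2 * pi * x)) / k.+1%:R.

Definition log_error (K : nat) x : R := `|ln (Normc.normc (1 - e2pi x)) + cos_sum K x|.

Lemma log_error_far K x : (0 < K)%N -> 0 < dint x ->
  log_error K x <= 8 / Num.sqrt K%:R / Num.sqrt (dint x).
Proof.
move=> K0 dx; have a_ge := dint_le_normc x; have a2 := normc_1_sub_e2pi_sqr x.
set a := Normc.normc _ in a_ge a2; have a0 : 0 < a by lra.
have c1 : cos (2 * pi * x) < 1 by have : 0 < a ^+ 2 := exprn_gt0 2 a0; lra.
have K0' : 0 < K%:R :> R by rewrite ltr0n.
have := log_cos_approx c1 K0; rewrite -a2 sqrtr_sqr [`|a|]gtr0_norm // lnXn //.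
rewrite -[ln a *+ 2]mulr_natr mulfK // => h; apply: (le_trans h).
rewrite -mulrA -invfM ler_wpM2l // -sqrtrM // lef_pV2 ?posrE ?sqrtr_gt0 ?mulr_gt0 //.
rewrite ler_sqrt; last by rewrite mulr_ge0 // ltW.
by rewrite mulrC ler_wpM2r //; lra.
Qed.

Lemma log_error_crude K x s : 0 <= s -> expR (- s) <= dint x ->
  log_error K x <= s + 1 + K%:R.
Proof.
move=> s0 sx; have a_ge := dint_le_normc x; have a2 := normc_1_sub_e2pi_sqr x.
have e0 := expR_gt0 (- s); rewrite /log_error.
set a := Normc.normc _ in a_ge a2 *; have a0 : 0 < a by lra.
have ale : a <= 2.
  rewrite -(@ler_pXn2r _ 2) ?nnegrE ?(ltW a0) // a2 (_ : 2 ^+ 2 = 4); last by ring.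
  by have := cos_geN1 (2 * pi * x); lra.
apply: (le_trans (ler_normD _ _)); apply: lerD.
  rewrite ler_norml; apply/andP; split.
    have : - s <= ln a by rewrite -[- s]expRK ler_ln ?posrE //; lra.
    by lra.
  have : ln a <= 1.
    rewrite -ler_expR lnK ?posrE //; apply: (le_trans ale).
    by have := @expR_ge1Dx R 1; lra.
  by lra.
apply: (le_trans (ler_norm_sum _ _ _)).
rewrite -[K in leRHS]card_ord -sumr_const; apply: ler_sum => k _.
rewrite normrM normfV normr_nat ler_pdivrMr ?ltr0n // mul1r.
by apply: (le_trans (cos_max _)); rewrite ler1n.
Qed.

(** This is [log (1 / ||n theta||) = o(n)], stated for coprime pairs as in [gelfond]; by
    [best_coprime] it covers the best approximations. *)
Definition exp_dioph theta := forall eps : R, 0 < eps -> exists n0 : nat,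
  forall (n : nat) (m : int), (n0 <= n)%N -> coprime n `|m|%N ->
    expR (- (eps * n%:R)) <= `|n%:R * theta - m%:~R|.

Lemma sum_blocks (F : nat -> R) (N q : nat) (b : R) : (0 < q)%N ->
  (forall i, 0 <= F i) -> (forall c, \sum_(i < q) F (c * q + i)%N <= b) ->
  \sum_(i < N) F i <= (N %/ q).+1%:R * b.
Proof.
move=> q0 F0 Fb; have NM : (N <= (N %/ q).+1 * q)%N by rewrite ltnW // ltn_ceil.
apply: (@le_trans _ _ (\sum_(0 <= i < (N %/ q).+1 * q) F i)).
  rewrite -(big_mkord xpredT) [leRHS](@big_cat_nat _ _ _ N) //= lerDl.
  by rewrite sumr_ge0.
elim: (N %/ q).+1 => [|m IH]; first by rewrite mul0n big_geq // mul0r.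
rewrite (@big_cat_nat _ _ _ (m * q)) //=; last by rewrite mulSn leq_addl.
rewrite -addn1 natrD mulrDl mul1r lerD //; apply: le_trans (Fb m).
rewrite -{1}[(m * q)%N]add0n big_addn big_mkord mulnDl mul1n addKn.
by rewrite le_eqVlt; apply/orP; left; apply/eqP; apply: eq_bigr => i _; rewrite addnC.
Qed.

Lemma sum_log_error_le theta (N q K : nat) (s : R) : irrational theta ->
  (0 < K)%N -> best theta N q -> 0 <= s -> expR (- s) <= dint (q%:R * theta) ->
  \sum_(1 <= n < N.+1) log_error K (n%:R * theta) <=
  (N %/ q).+1%:R * (2 * (s + 1 + K%:R) + 64 / Num.sqrt K%:R * q%:R).
Proof.
move=> irr K0 bq s0 sq; have [/andP[q0 qN] qmin] := bq.
(* Shifted to start at 0, and extended by 0 so that the last block is complete. *)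
pose F i := if (i < N)%N then log_error K (i.+1%:R * theta) else 0.
have F0 i : 0 <= F i by rewrite /F; case: ifP => // _; exact: normr_ge0.
rewrite big_add1 /= big_mkord (eq_bigr (fun i : 'I_N => F i)); last first.
  by move=> i _; rewrite /F ltn_ord.
apply: sum_blocks => // c.
have K0' : 0 < K%:R :> R by rewrite ltr0n.
have h := @block_sum_le R q theta (s + 1 + K%:R) (8 / Num.sqrt K%:R)
  (fun i => F (c * q + i)%N) (c * q).+1 q0.
apply: le_trans (h _ _ _ _ _) _.
- by rewrite !addr_ge0.
- by rewrite divr_ge0 // sqrtr_ge0.
- exact: best_separation bq.
- move=> i; rewrite /F; case: ifP => [lt|_]; last by rewrite !addr_ge0.
  by apply: log_error_crude => //; apply: (le_trans sq); apply: qmin.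
- move=> i; rewrite /F addSn; case: ifP => [lt|_] dx.
    exact: log_error_far.
  by rewrite !mulr_ge0 ?invr_ge0 ?sqrtr_ge0.
by rewrite lerD2l le_eqVlt; apply/orP; left; apply/eqP; ring.
Qed.

Lemma log_error_average theta (eta : R) : irrational theta -> exp_dioph theta -> 0 < eta ->
  exists K0, forall K, (K0 <= K)%N -> exists N0, forall N, (N0 <= N)%N ->
    \sum_(1 <= n < N.+1) log_error K (n%:R * theta) <= eta * N%:R.
Proof.
(* This choice gives [64 / sqrt K <= eta / 8]. *)
move=> irr H eta0; pose K0 := Num.bound ((512 / eta) ^+ 2).
exists K0.+1 => K KK.
have Kgt0 : (0 < K)%N by exact: leq_trans KK.
have K0' : 0 < K%:R :> R by rewrite ltr0n.
have sK : 128 / Num.sqrt K%:R <= eta / 4.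
  have s0 : 0 < Num.sqrt K%:R :> R by rewrite sqrtr_gt0.
  rewrite ler_pdivrMr // mulrC -ler_pdivrMr ?divr_gt0 //.
  have -> : 128 / (eta / 4) = 512 / eta by field; rewrite gt_eqF.
  rewrite -(@ler_pXn2r _ 2) ?nnegrE ?sqrtr_ge0 ?divr_ge0 ?(ltW eta0) //.
  rewrite sqr_sqrtr ?(ltW K0') //.
  apply: ltW; apply: lt_le_trans (archi_boundP (sqr_ge0 _)) _.
  by rewrite ler_nat ltnW.
have e16 : 0 < eta / 16 by rewrite divr_gt0.
have [n0 Hn0] := H _ e16.
pose Q := Num.bound (16 * (1 + K%:R) / eta).
have [N0 HN0] := best_tends_infty irr (n0 + Q).
exists N0.+1 => N NN; have N_gt0 : (0 < N)%N by exact: leq_trans NN.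
have [q bq] := best_exists theta N_gt0.
have qbig := HN0 _ _ (ltnW NN) bq; have [/andP[q0 qN] _] := bq.
have qR : 0 < q%:R :> R by rewrite ltr0n.
have sq : expR (- (eta / 16 * q%:R)) <= dint (q%:R * theta).
  refine (Hn0 q _ _ (best_coprime irr bq)).
  by apply: leq_trans (ltnW qbig); rewrite leq_addr.
have s0 : 0 <= eta / 16 * q%:R by rewrite mulr_ge0 // ltW.
apply: le_trans (sum_log_error_le irr Kgt0 bq s0 sq) _.
have Nq : (N %/ q).+1%:R * q%:R <= 2 * N%:R :> R.
  rewrite -!natrM ler_nat mulSn mul2n -addnn leq_add // leq_divM //.
have qK : 16 * (1 + K%:R) <= eta * q%:R.
  have qQ : (Q <= q)%N by apply: leq_trans (ltnW qbig); rewrite leq_addl.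
  have : 16 * (1 + K%:R) / eta <= q%:R.
    apply: ltW; apply: lt_le_trans (archi_boundP _) _; last by rewrite ler_nat.
    by rewrite divr_ge0 ?(ltW eta0) // mulr_ge0 // addr_ge0.
  by rewrite ler_pdivrMr // [q%:R * _]mulrC.
(* With [s = eta q / 16], each of [2 s], [2 (1 + K)] and the main term is at most [eta q / 8], and
   the number of blocks times [q] is at most [2 N]. *)
set X := _ + _; apply: (@le_trans _ _ ((N %/ q).+1%:R * (eta / 2 * q%:R))).
  rewrite ler_wpM2l // /X.
  have h : 64 / Num.sqrt K%:R * q%:R <= eta / 8 * q%:R.
    by rewrite ler_wpM2r //; lra.
  by lra.
have h := ler_wpM2l (ltW eta0) Nq; lra.
Qed.
End ErrorAverage.

(** * Rational independence and exponential averages *)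

Section RationalDimension.
Variable R : realType.
Implicit Types (theta alpha : R).

Lemma Qspan_tnth n (x : n.-tuple R) i : Qspan x (tnth x i).
Proof.
exists (fun j => (j == i)%:R); rewrite (bigD1 i) //= eqxx rmorph1 mul1r big1 ?addr0 //.
by move=> j /negPf ->; rewrite rmorph0 mul0r.
Qed.

(* If [b] is a basis of the span of [x], with [b = B x] and [x = A b], then
   [B A = 1], hence [A B = 1]. *)
Lemma Qdim_free n (x : n.-tuple R) : Qdim (Qspan x) n -> Qfree x.
Proof.
move=> [b [bfree bx]] c cx0.
have [A HA] : exists A : 'I_n -> 'I_n -> rat,
    forall i, tnth x i = \sum_j ratr (A i j) * tnth b j.
  apply: (@fin_all_exists _ (fun _ => 'I_n -> rat)
    (fun i f => tnth x i = \sum_j ratr (f j) * tnth b j)) => i.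
  by have := Qspan_tnth x i; rewrite -bx.
have [B HB] : exists B : 'I_n -> 'I_n -> rat,
    forall i, tnth b i = \sum_j ratr (B i j) * tnth x j.
  apply: (@fin_all_exists _ (fun _ => 'I_n -> rat)
    (fun i f => tnth b i = \sum_j ratr (f j) * tnth x j)) => i.
  by have := Qspan_tnth b i; rewrite bx.
pose MA := \matrix_(i, j) A i j; pose MB := \matrix_(i, j) B i j.
have subst (f : 'I_n -> rat) : \sum_j ratr (f j) * tnth x j =
    \sum_k ratr ((\row_j f j *m MA) 0 k) * tnth b k.
  under eq_bigr => j _ do rewrite HA mulr_sumr.
  rewrite exchange_big /=; apply: eq_bigr => k _.
  rewrite mxE rmorph_sum mulr_suml; apply: eq_bigr => j _.
  by rewrite !mxE rmorphM mulrA.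
have BA1 : MB *m MA = 1%:M.
  apply/matrixP => i k; apply/eqP; rewrite -subr_eq0; apply/eqP.
  apply: (bfree (fun k => (MB *m MA) i k - 1%:M i k)).
  under eq_bigr => j _ do rewrite rmorphB mulrBl.
  rewrite sumrB; apply/eqP; rewrite subr_eq0; apply/eqP.
  transitivity (tnth b i); last first.
    rewrite (bigD1 i) //= mxE eqxx rmorph1 mul1r big1 ?addr0 // => j.
    by rewrite eq_sym mxE => /negPf ->; rewrite rmorph0 mul0r.
  rewrite [RHS]HB subst; apply: eq_bigr => j _; congr (ratr _ * _).
  by rewrite !mxE; apply: eq_bigr => l _; rewrite !mxE.
have cA : \row_j c j *m MA = 0.
  apply/rowP => k; rewrite [RHS]mxE; apply: (bfree (fun k => (\row_j c j *m MA) 0 k)).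
  by rewrite -subst.
have : \row_j c j = 0 by rewrite -[LHS]mulmx1 -(mulmx1C BA1) mulmxA cA mul0mx.
by move=> /rowP c0 i; have := c0 i; rewrite !mxE.
Qed.

Lemma irrational_not_ratr (theta : R) : (forall q, theta <> ratr q) -> irrational theta.
Proof. by move=> h; rewrite irrationalE => q _ [/= r -> e]; apply: (h q); rewrite -e. Qed.

Lemma Qdim2_irrational theta : Qdim (Qspan [tuple 1; theta]) 2 -> irrational theta.
Proof.
move=> /Qdim_free fr; apply: irrational_not_ratr => q e.
have := fr (fun i => if i == 0 then - q else 1).
rewrite !big_ord_recl big_ord0 /= !(tnth_nth 0) /= rmorphN rmorph1 e mulr1 mul1r addr0 addNr.
by move=> /(_ erefl 1) /= /eqP; rewrite oner_eq0.
Qed.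

Lemma Qdim3_irrational theta alpha : Qdim (Qspan [tuple 1; theta; alpha]) 3 -> irrational theta.
Proof.
move=> /Qdim_free fr; apply: irrational_not_ratr => q e.
have := fr (fun i => if i == 0 then - q else if i == 1 then 1 else 0).
rewrite !big_ord_recl big_ord0 /= !(tnth_nth 0) /= rmorphN rmorph1 rmorph0 e.
rewrite mulr1 mul1r mul0r !addr0 addNr.
by move=> /(_ erefl 1) /= /eqP; rewrite oner_eq0.
Qed.

Lemma Qdim3_independent theta alpha : Qdim (Qspan [tuple 1; theta; alpha]) 3 ->
  forall m k l : int, m != 0 -> k%:~R * theta + m%:~R * alpha <> l%:~R.
Proof.
move=> /Qdim_free fr m k l m0 e.
have := fr (fun i => if i == 0 then - l%:~R else if i == 1 then k%:~R else m%:~R).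
rewrite !big_ord_recl big_ord0 /= !(tnth_nth 0) /= rmorphN /= !ratr_int mulr1 addr0 e addNr.
by move=> /(_ erefl 2) /= /eqP; rewrite intr_eq0 (negPf m0).
Qed.

Lemma irrational_mul_ratr theta (r : rat) (l : int) : irrational theta -> r != 0 ->
  ratr r * theta <> l%:~R.
Proof.
move=> irr r0 e; apply: (irrational_ratr irr (q := l%:~R / r)).
have nz : ratr r != 0 :> R by rewrite fmorph_eq0.
by apply: (mulfI nz); rewrite e rmorphM fmorphV /= ratr_int mulrC divfK.
Qed.

(** From [n ||n theta|| >= c] it is enough that [c exp(eps n) >= n], which the quadratic term of the
    exponential gives for large [n]. *)
Lemma badly_approximable_dioph theta : badly_approximable theta -> exp_dioph theta.
Proof.
move=> [irr]; set S := [set _ | _ in _]; set c := inf S => c0 eps eps0.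
have lbS : has_lbound S.
  exists 0 => _ [n _ <-]; rewrite mulr_ge0 // lb_le_inf //.
    by exists `|n%:R * theta - 0%:~R|; exists 0.
  by move=> _ [k _ <-].
have cS (n : nat) (m : int) : (0 < n)%N -> c <= n%:R * `|n%:R * theta - m%:~R|.
  move=> n0; apply: (@le_trans _ _ (n%:R * dist_int (n%:R * theta))).
    by apply: ge_inf => //; exists n.
  rewrite ler_wpM2l // /dist_int; apply: ge_inf; last by exists m.
  by exists 0 => _ [k _ <-].
exists (Num.bound (2 / (c * eps ^+ 2))).+1 => n m nn _.
have n0 : (0 < n)%N by exact: leq_trans nn.
have nR : 0 < n%:R :> R by rewrite ltr0n.
have ce0 : 0 < c * eps ^+ 2 by rewrite mulr_gt0 // exprn_gt0.
have nbig : 2 <= n%:R * (c * eps ^+ 2).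
  rewrite -ler_pdivrMr //; apply: ltW; apply: lt_le_trans (archi_boundP _) _.
    by rewrite divr_ge0 // ltW.
  by rewrite ler_nat ltnW.
have en0 : 0 <= eps * n%:R by rewrite mulr_ge0 // ltW.
have := expR_ge1Dxn 1 en0 => h1.
rewrite -(ler_pM2l nR) (le_trans _ (cS n m n0)) // expRN ler_pdivrMr ?expR_gt0 //.
have h2 := ler_wpM2l (ltW c0) h1; apply: le_trans h2.
rewrite (_ : 2`!%:R = 2) // exprMn.
have h3 := ler_wpM2r (ltW nR) nbig.
rewrite !expr2 in h3 *; lra.
Qed.

End RationalDimension.

(** * Limits of averages of exponentials *)

Section Limits.
Variable R : realType.
Local Notation C := R[i].
Implicit Types (theta beta gamma : R).

(** Real [eps] and real modulus, whereas the topology behind [clim_to] takes its radii among the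
    positive elements of [R[i]]; those are real. *)
Definition tends_to (u : nat -> C) (l : C) : Prop := forall eps : R, 0 < eps ->
  exists N0, forall N, (N0 <= N)%N -> Normc.normc (u N - l) <= eps.

Lemma tends_to_clim (u : nat -> C) (l : C) : tends_to u l -> clim_to u l.
Proof.
move=> ul; apply/(@cvgrPdist_le C C^o) => e e0.
have e_re : e = (complex.Re e)%:C by rewrite RRe_real // gtr0_real.
have re0 : 0 < complex.Re e by move: e0; rewrite e_re ltcR.
have [N0 HN0] := ul _ re0; exists N0 => // N /= NN.
by rewrite e_re distrC norm_normc lecR; exact: HN0.
Qed.

Lemma tends_toD u v a b : tends_to u a -> tends_to v b -> tends_to (fun N => u N + v N) (a + b).
Proof.
move=> ua vb eps eps0; have e2 : 0 < eps / 2 by rewrite divr_gt0.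
have [N1 H1] := ua _ e2; have [N2 H2] := vb _ e2.
exists (maxn N1 N2) => N; rewrite geq_max => /andP[n1 n2].
have -> : u N + v N - (a + b) = (u N - a) + (v N - b) by ring.
by apply: (le_trans (le_normcD _ _)); have := H1 _ n1; have := H2 _ n2; lra.
Qed.

Lemma tends_toZ (c : C) u a : tends_to u a -> tends_to (fun N => c * u N) (c * a).
Proof.
move=> ua eps eps0; have c0 := normc_ge0 c.
have e2 : 0 < eps / (Normc.normc c + 1) by rewrite divr_gt0 // ltr_wpDl.
have [N1 H1] := ua _ e2; exists N1 => N /H1 h.
rewrite -mulrBr Normc.normcM; apply: (le_trans (ler_wpM2l c0 h)).
rewrite mulrA ler_pdivrMr ?ltr_wpDl // mulrC ler_wpM2l ?(ltW eps0) //; lra.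
Qed.

Lemma tends_to_sum n (u : 'I_n -> nat -> C) (a : 'I_n -> C) :
  (forall i, tends_to (u i) (a i)) -> tends_to (fun N => \sum_i u i N) (\sum_i a i).
Proof.
elim: n u a => [|n IH] u a ua.
  by move=> eps eps0; exists 0%N => N _; rewrite !big_ord0 subrr Normc.normc0 ltW.
have h := tends_toD (ua ord0) (IH _ _ (fun i => ua (lift ord0 i))).
rewrite big_ord_recl; move=> eps /h [N0 H0]; exists N0 => N /H0.
by rewrite big_ord_recl.
Qed.

Definition exp_average gamma (N : nat) : C := N%:R^-1 * \sum_(1 <= n < N.+1) e2pi (n%:R * gamma).

Lemma normc_nat (n : nat) : Normc.normc (n%:R : C) = n%:R.
Proof. by apply: complexI; rewrite -norm_normc normr_nat natr_complex. Qed.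

Lemma exp_average_tends_to gamma :
  tends_to (exp_average gamma) (e2pi gamma == 1)%:R.
Proof.
have [e1|ne1] := eqVneq (e2pi gamma) 1 => eps eps0.
  exists 1%N => N N0; rewrite /exp_average.
  have -> : \sum_(1 <= n < N.+1) e2pi (n%:R * gamma) = N%:R.
    under eq_bigr => n _ do rewrite e2piMn e1 expr1n.
    by rewrite sumr_const_nat subn1.
  by rewrite mulVf ?pnatr_eq0 -?lt0n // subrr Normc.normc0 ltW.
set z := e2pi gamma in ne1.
have d0 : 0 < Normc.normc (1 - z).
  by rewrite -ltcR -norm_normc normr_gt0 subr_eq0 eq_sym.
exists (Num.bound (2 / Normc.normc (1 - z) / eps)).+1 => N NN.
have N0 : 0 < N%:R :> R by rewrite ltr0n; exact: leq_trans NN.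
rewrite subr0 /exp_average Normc.normcM Normc.normcV normc_nat.
have geo : (1 - z) * \sum_(1 <= n < N.+1) e2pi (n%:R * gamma) = z * (1 - z ^+ N).
  rewrite big_add1 /= big_mkord -[1 - z ^+ N]opprB subrX1.
  under eq_bigr => n _ do rewrite e2piMn exprS.
  by rewrite -mulr_sumr -/z; ring.
have : Normc.normc (1 - z) * Normc.normc (\sum_(1 <= n < N.+1) e2pi (n%:R * gamma)) <= 2.
  rewrite -Normc.normcM geo Normc.normcM normc_cis mul1r -lecR -norm_normc.
  apply: (le_trans (ler_normB _ _)).
  by rewrite normr1 normrX norm_e2pi expr1n rmorphD.
set s := Normc.normc (\sum_(_ <= _ < _) _) => h.
rewrite mulrC ler_pdivrMr // -(ler_pM2l d0); apply: (le_trans h).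
have key : 2 / Normc.normc (1 - z) / eps <= N%:R.
  apply: ltW; apply: lt_le_trans (archi_boundP _) _; last by rewrite ler_nat ltnW.
  by rewrite !divr_ge0 // ltW.
by rewrite ler_pdivrMr // ler_pdivrMr // in key; lra.
Qed.

End Limits.

(** * Limits of the logarithmic averages *)

Section LogAverages.
Variable R : realType.
Local Notation C := R[i].
Implicit Types (theta beta : R).

Lemma e2pi_add_opp (y : R) : e2pi y + e2pi (- y) = (2 * cos (2 * pi * y))%:C.
Proof.
rewrite /e2pi mulrN /cis cosN sinN.
by apply/eqP; rewrite eq_complex /= subrr eqxx andbT; apply/eqP; ring.
Qed.

(** The frequencies [k + 1] and [- (k + 1)] of [log|1 - e(x)|], with Fourier coefficient
    [- 1 / (2 (k + 1))], shifted by [beta]. As a function of the frequency, [f] is in turn the value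
    at [n], the average and its limit. *)
Definition fourier_mode theta beta (k : nat) (f : R -> C) : C :=
  - (2 * k.+1%:R)^-1 * (f (k.+1%:R * theta + beta) + f (- (k.+1%:R * theta) + beta)).

Lemma cos_sum_fourier K theta beta (n : nat) :
  \sum_(k < K) fourier_mode theta beta k (fun g => e2pi (n%:R * g)) =
  - (cos_sum K (n%:R * theta))%:C * e2pi (n%:R * beta).
Proof.
rewrite /cos_sum rmorph_sum -sumrN mulr_suml; apply: eq_bigr => k _.
rewrite /fourier_mode ![n%:R * (_ + _)]mulrDr !e2piD -mulrDl mulrN e2pi_add_opp.
have -> : k.+1%:R * (2 * pi * (n%:R * theta)) = 2 * pi * (n%:R * (k.+1%:R * theta)) by ring.
rewrite !rmorphM fmorphV /= !rmorph_nat; field.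
by rewrite nat1r pnatr_eq0.
Qed.

(** [K] is fixed first, so that truncation costs at most [eps / 2] for all large [N]; then the
    averages of the finitely many modes converge. *)
Lemma log_average_tends_to theta beta (l : C) (K1 : nat) :
  irrational theta -> exp_dioph theta ->
  (forall K, (K1 <= K)%N ->
    \sum_(k < K) fourier_mode theta beta k (fun g => (e2pi g == 1)%:R) = l) ->
  tends_to (log_average theta beta) l.
Proof.
move=> irr dio Hl eps eps0; have e2 : 0 < eps / 2 by rewrite divr_gt0.
have [K0 HK0] := log_error_average irr dio e2.
pose K := maxn K0 K1; have [N1 HN1] := HK0 K (leq_maxl _ _).
have main : tends_to (fun N => \sum_(k < K) fourier_mode theta beta k (fun g => exp_average g N)) l.
  rewrite -(Hl K (leq_maxr _ _)); apply: tends_to_sum => k; apply: tends_toZ.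
  by apply: tends_toD; exact: exp_average_tends_to.
have [N2 HN2] := main _ e2.
exists (maxn (maxn N1 N2) 1) => N; rewrite !geq_max => /andP[/andP[n1 n2] n0].
have nR : 0 < N%:R :> R by rewrite ltr0n.
have Ec : \sum_(k < K) fourier_mode theta beta k (fun g => exp_average g N) =
    N%:R^-1 * \sum_(1 <= n < N.+1) - (cos_sum K (n%:R * theta))%:C * e2pi (n%:R * beta).
  under [in RHS]eq_bigr => n _ do rewrite -cos_sum_fourier.
  rewrite exchange_big mulr_sumr; apply: eq_bigr => k _.
  rewrite /fourier_mode -mulr_sumr big_split /= /exp_average; ring.
have diff : Normc.normc (log_average theta beta N -
    \sum_(k < K) fourier_mode theta beta k (fun g => exp_average g N)) <= eps / 2.
  rewrite Ec /log_average -mulrBr -sumrB Normc.normcM Normc.normcV normc_nat.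
  rewrite mulrC ler_pdivrMr //; apply: le_trans (HN1 _ n1).
  rewrite -lecR -norm_normc rmorph_sum; apply: (le_trans (ler_norm_sum _ _ _)).
  apply: ler_sum => n _; rewrite mulNr opprK -mulrDl normrM norm_e2pi mulr1.
  by rewrite -rmorphD norm_complex_of_real.
set u := log_average theta beta N in diff *; set v := \sum_(k < K) _ in diff.
have -> : u - l = (u - v) + (v - l) by ring.
apply: (le_trans (le_normcD _ _)); have := HN2 N n2; rewrite -/v => h; lra.
Qed.

(** The constant Fourier coefficient of the logarithm is 0, so only [k != 0] matters and [beta = 0]
    is allowed. *)
Lemma log_average_tends_to0 theta beta : irrational theta -> exp_dioph theta ->
  (forall k l : int, k != 0 -> k%:~R * theta + beta <> l%:~R) ->
  tends_to (log_average theta beta) 0.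
Proof.
move=> irr dio nint_beta; apply: (log_average_tends_to (K1 := 0%N) irr dio) => K _.
have H (k : int) : k != 0 -> (e2pi (k%:~R * theta + beta) == 1) = false.
  move=> k0; apply/negP => /eqP /e2pi_eq1; exact: nint_beta.
rewrite big1 // => k _; rewrite /fourier_mode -mulNr.
have := H (Posz k.+1); have := H (Negz k).
by rewrite NegzE mulrNz -!pmulrn => -> // -> //; rewrite addr0 mulr0.
Qed.

(** For [m != 0] only the mode with [k + 1 = |m|] has a nonzero limit, from exactly one of its two
    frequencies; the sum is constant from [K = |m|] on. *)
Lemma log_average_int_tends_to theta (m : int) : irrational theta -> exp_dioph theta ->
  tends_to (log_average theta (m%:~R * theta))
    (if m == 0 then 0 else - (2 * `|m|%:~R)^-1).
Proof.
move=> irr dio; have H (k : int) : (e2pi (k%:~R * theta) == 1) = (k == 0).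
  have [->|k0] := eqVneq k 0; first by rewrite mul0r e2pi0 eqxx.
  apply/negP => /eqP /e2pi_eq1; rewrite -ratr_int.
  by apply: irrational_mul_ratr; rewrite ?intr_eq0.
have [->|m0] := eqVneq m 0.
  apply: log_average_tends_to0 => // k l k0; rewrite mul0r addr0 -ratr_int.
  by apply: irrational_mul_ratr; rewrite ?intr_eq0.
apply: (log_average_tends_to (K1 := `|m|%N) irr dio) => K mK.
have mode (k : nat) : fourier_mode theta (m%:~R * theta) k (fun g => (e2pi g == 1)%:R) =
    - (2 * k.+1%:R)^-1 * (k.+1 == `|m|%N)%:R :> C.
  rewrite /fourier_mode -mulNr -!mulrDl.
  have -> : k.+1%:R + m%:~R = (k.+1%:Z + m)%:~R :> R by rewrite intrD -pmulrn.
  have -> : - k.+1%:R + m%:~R = (- k.+1%:Z + m)%:~R :> R by rewrite intrD mulrNz -pmulrn.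
  rewrite !H -natrD; congr (_ * _%:R).
  by case: m {mK} m0 => [[|p]|p] // _; lia.
have m1 : (`|m|.-1 < K)%N by rewrite prednK // absz_gt0.
rewrite (bigD1 (Ordinal m1)) //= mode prednK ?absz_gt0 // eqxx mulr1 big1 ?addr0.
  by congr (- (2 * _)^-1); rewrite -abszE -pmulrn.
move=> k; rewrite -val_eqE /= mode => nk.
have -> : (k.+1 == `|m|%N) = false.
  by apply/eqP => e; move: nk; rewrite -e /= eqxx.
by rewrite mulr0.
Qed.

End LogAverages.

Theorem theorem6p1 (R : realType) :
  exists C : rat -> R[i],
    (forall m : rat, m \isn't a Num.int ->
       exists2 X : set (int -> R[i]),
         forall chi, X chi ->
           dirichlet_character (2 * `|denq m|) chi /\
           ~ principal_character (2 * `|denq m|) chi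
         & field_generated
             (@roots_of_unity R `|` [set (pi : R)%:C] `|` [set dirichlet_L 1 chi | chi in X])
             (C m)) /\
    forall theta : R,
      algebraicOver (ratr : rat -> R[i]) (e2pi theta) \/
        badly_approximable theta ->
      (Qdim (Qspan [tuple 1; theta]) 2 ->
         (forall m : int,
            clim_to (log_average theta (m%:~R * theta))
              (if m == 0 then 0 else - (2 * `|m|%:~R)^-1)) /\
         (forall m : rat, m \isn't a Num.int ->
            clim_to (log_average theta (ratr m * theta)) (C m))) /\
      (forall alpha : R,
         Qdim (Qspan [tuple 1; theta; alpha]) 3 ->
         forall m : int,
           clim_to (log_average theta (m%:~R * alpha)) 0).
Proof.
exists (fun=> 0); split.
  (* [0 = 1 - 1] lies in every subfield, so the empty set of characters serves. *)
  move=> m _; exists set0 => // F divF _.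
  have [F1 FB _] := divF.
  by rewrite -(subrr 1) FB.
move=> theta hyp.
have dio : irrational theta -> exp_dioph theta.
  move=> irr; case: hyp => [alg|/badly_approximable_dioph //].
  by move=> eps; apply: gelfond.
split=> [/Qdim2_irrational irr|alpha dim3 m].
  split=> m; first by apply: tends_to_clim; apply: log_average_int_tends_to => //; exact: dio.
  move=> mint; apply: tends_to_clim; apply: log_average_tends_to0 => //; first exact: dio.
  (* [(k + m) theta] is an integer only if [k + m = 0], which would make [m] an integer. *)
  move=> k l _; rewrite -ratr_int -mulrDl -rmorphD.
  apply: irrational_mul_ratr => //; apply: contra mint.
  by rewrite addrC addr_eq0 => /eqP ->; rewrite -rmorphN /= intr_int.
have irr := Qdim3_irrational dim3.
apply: tends_to_clim; have [->|m0] := eqVneq m 0.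
  by have := log_average_int_tends_to 0 irr (dio irr); rewrite eqxx !mul0r.
by apply: log_average_tends_to0 => // [|k l _]; [exact: dio|exact: Qdim3_independent].
Qed.
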